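(* Over $\mathsf{RCA}_0$, each of the following statements is equivalent to arithmetic comprehension (i.e., to $\mathsf{ACA}_0$): (1) Every compact countable second-countable space is effectively compact. (2) Every discrete countable second-countable space is effectively discrete. (2') Every discrete effectively compact countable second-countable space is effectively discrete. (3) Every Hausdorff countable second-countable space is effectively Hausdorff. (3') Every Hausdorff effectively compact countable second-countable space is effectively Hausdorff.
   Context: All definitions are made in second-order arithmetic, over the base theory $\mathsf{RCA}_0$. Finite sets of natural numbers are coded by natural numbers; $I^{[<\infty]}$ denotes the set of all (codes of) finite subsets of $I$. An enumerable set is a nondecreasing sequence $A=\langle a_n\rangle_{n=0}^\infty$ of finite sets, representing $\bigcup_n a_n$ (which need not exist as a set); $x\in A$ abbreviates $(\exists n)(x\in a_n)$. Equivalently, an enumerable set is a $\Sigma^0_1$-definable class (parameters allowed). A countable second-countable space is a triple $(X,\mathcal U,k)$ where $X\subseteq\mathbb N$ is a set, $\mathcal U=\langle U_i\rangle_{i\in I}$ is an indexed sequence of subsets of $X$ and $k:X\times I\times I\to I$ is a function such that every $x\in X$ is in some $U_i$, and whenever $x\in U_i\cap U_j$ then $x\in U_{k(x,i,j)}\subseteq U_i\cap U_j$. The space is compact if for every enumerable set $A\subseteq I$ with $X=\bigcup_{i\in A}U_i$ there is a finite set $a\subseteq A$ with $X=\bigcup_{i\in a}U_i$. The sequence $\mathcal U$ has a finite cover relation if there is a set $C\subseteq I^{[<\infty]}$ such that for all finite $\{i_0,\dots,i_{\ell-1}\}\subseteq I$: $\{i_0,\dots,i_{\ell-1}\}\in C\leftrightarrow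 X=U_{i_0}\cup\cdots\cup U_{i_{\ell-1}}$. The space is effectively compact if it is compact and $\mathcal U$ has a finite cover relation. The space is discrete if for every $x\in X$ there is $i\in I$ with $U_i=\{x\}$; it is effectively discrete if there is a function $d:X\to I$ with $U_{d(x)}=\{x\}$ for every $x\in X$. It is Hausdorff if any two distinct points $x_0,x_1\in X$ have disjoint basic open neighborhoods $U_i\ni x_0$, $U_j\ni x_1$; it is effectively Hausdorff if there are functions $h_0,h_1:X\times X\to I$ such that whenever $x_0\ne x_1$ we have $x_0\in U_{h_0(x_0,x_1)}$, $x_1\in U_{h_1(x_0,x_1)}$ and $U_{h_0(x_0,x_1)}\cap U_{h_1(x_0,x_1)}=\varnothing$. *)

(* Defs.v *)
Set Implicit Arguments.
Unset Strict Implicit.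
Unset Printing Implicit Defensive.

(** * Structures for the language of second-order arithmetic *)

(* Two-sorted (Henkin) structures: [num] need not be standard and [set] need
   not contain every subset of [num].  Equality of sets is not a primitive of
   the language, so no extensionality is imposed on the set sort.  As usual in
   first-order logic, both sorts are nonempty. *)
Record L2_structure := L2Structure {
  num : Type;
  set : Type;
  zero : num;
  one : num;
  add : num -> num -> num;
  mul : num -> num -> num;
  lt : num -> num -> Prop;
  mem : num -> set -> Prop;
  set_inhabited : inhabited set
}.

Arguments zero {_}.
Arguments one {_}.

Declare Scope L2_scope.
Delimit Scope L2_scope with L2.
Notation "x + y" := (add x y) : L2_scope.
Notation "x * y" := (mul x y) : L2_scope.
Notation "x < y" := (lt x y) : L2_scope.
Notation "x \in X" := (mem x X) (at level 70, no associativity) : L2_scope.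
Notation "0" := zero : L2_scope.
Notation "1" := one : L2_scope.
Local Open Scope L2_scope.

(** * Formulas *)

(* De Bruijn indices, counted separately for the number and the set sort. *)
Inductive term :=
  | TVar (n : nat)
  | TZero
  | TOne
  | TAdd (s t : term)
  | TMul (s t : term).

(* In [FBAll t A] and [FBEx t A], i.e. (forall x < t) A and (exists x < t) A,
   the quantifier binds a number variable in [A] but not in [t]. *)
Inductive formula :=
  | FEq (s t : term)
  | FLt (s t : term)
  | FMem (t : term) (X : nat)
  | FNot (A : formula)
  | FAnd (A B : formula)
  | FOr (A B : formula)
  | FImp (A B : formula)
  | FBAll (t : term) (A : formula)
  | FBEx (t : term) (A : formula)
  | FAll (A : formula)
  | FEx (A : formula)
  | FAllSet (A : formula)
  | FExSet (A : formula).

Definition scons (T : Type) (x : T) (e : nat -> T) (n : nat) : T :=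
  match n with O => x | S m => e m end.

Fixpoint eval (M : L2_structure) (e : nat -> num M) (t : term) : num M :=
  match t with
  | TVar n => e n
  | TZero => 0
  | TOne => 1
  | TAdd s t => eval e s + eval e t
  | TMul s t => eval e s * eval e t
  end.

Fixpoint sat (M : L2_structure) (e : nat -> num M) (E : nat -> set M)
    (A : formula) : Prop :=
  match A with
  | FEq s t => eval e s = eval e t
  | FLt s t => eval e s < eval e t
  | FMem t X => eval e t \in E X
  | FNot A => ~ sat e E A
  | FAnd A B => sat e E A /\ sat e E B
  | FOr A B => sat e E A \/ sat e E B
  | FImp A B => sat e E A -> sat e E B
  | FBAll t A => forall x, x < eval e t -> sat (scons x e) E A
  | FBEx t A => exists x, x < eval e t /\ sat (scons x e) E A
  | FAll A => forall x, sat (scons x e) E A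
  | FEx A => exists x, sat (scons x e) E A
  | FAllSet A => forall X, sat e (scons X E) A
  | FExSet A => exists X, sat e (scons X E) A
  end.

Fixpoint bounded (A : formula) : Prop :=
  match A with
  | FEq _ _ | FLt _ _ | FMem _ _ => True
  | FNot A | FBAll _ A | FBEx _ A => bounded A
  | FAnd A B | FOr A B | FImp A B => bounded A /\ bounded B
  | FAll _ | FEx _ | FAllSet _ | FExSet _ => False
  end.

Definition Sigma01 (A : formula) : Prop :=
  exists B, bounded B /\ A = FEx B.

Definition Pi01 (A : formula) : Prop :=
  exists B, bounded B /\ A = FAll B.

Fixpoint arithmetical (A : formula) : Prop :=
  match A with
  | FEq _ _ | FLt _ _ | FMem _ _ => True
  | FNot A | FBAll _ A | FBEx _ A | FAll A | FEx A => arithmetical A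
  | FAnd A B | FOr A B | FImp A B => arithmetical A /\ arithmetical B
  | FAllSet _ | FExSet _ => False
  end.

(** * The systems RCA_0 and ACA_0 *)

Record basic_axioms (M : L2_structure) : Prop := BasicAxioms {
  succ_neq0 : forall n : num M, n + 1 <> 0;
  succ_inj : forall m n : num M, m + 1 = n + 1 -> m = n;
  add_0 : forall m : num M, m + 0 = m;
  add_succ : forall m n : num M, m + (n + 1) = (m + n) + 1;
  mul_0 : forall m : num M, m * 0 = 0;
  mul_succ : forall m n : num M, m * (n + 1) = m * n + m;
  nlt_0 : forall m : num M, ~ (m < 0);
  lt_succ : forall m n : num M, m < n + 1 <-> (m < n \/ m = n)
}.

(* In the schemes below, number variable 0 of the formula is the variable of
   induction or comprehension; all other variables are parameters, over whose
   values [e] and [E] one quantifies universally. *)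
Definition Sigma01_induction (M : L2_structure) : Prop :=
  forall A, Sigma01 A ->
  forall (e : nat -> num M) (E : nat -> set M),
    sat (scons 0 e) E A ->
    (forall n, sat (scons n e) E A -> sat (scons (n + 1) e) E A) ->
    forall n, sat (scons n e) E A.

Definition Delta01_comprehension (M : L2_structure) : Prop :=
  forall A B, Sigma01 A -> Pi01 B ->
  forall (e : nat -> num M) (E : nat -> set M),
    (forall n, sat (scons n e) E A <-> sat (scons n e) E B) ->
    exists X : set M, forall n, n \in X <-> sat (scons n e) E A.

Definition set_induction (M : L2_structure) : Prop :=
  forall X : set M,
    0 \in X -> (forall n, n \in X -> n + 1 \in X) -> forall n, n \in X.

Definition arithmetical_comprehension (M : L2_structure) : Prop :=
  forall A, arithmetical A ->
  forall (e : nat -> num M) (E : nat -> set M),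
    exists X : set M, forall n, n \in X <-> sat (scons n e) E A.

Record RCA0 (M : L2_structure) : Prop := MkRCA0 {
  RCA0_basic : basic_axioms M;
  RCA0_induction : Sigma01_induction M;
  RCA0_comprehension : Delta01_comprehension M
}.

Record ACA0 (M : L2_structure) : Prop := MkACA0 {
  ACA0_basic : basic_axioms M;
  ACA0_induction : set_induction M;
  ACA0_comprehension : arithmetical_comprehension M
}.

(** * Coding inside a structure *)

(* From here on, quantifiers range only over [num M] and [set M], so that each
   closed statement is the Tarskian truth condition in [M] of a sentence of
   second-order arithmetic. *)

Definition code_pair (M : L2_structure) (i j : num M) : num M :=
  (i + j) * (i + j) + i.
Notation "<< i , j >>" := (code_pair i j) : L2_scope.

(* A function between two definable classes is a set of coded pairs. *)
Definition is_function (M : L2_structure) (D R : num M -> Prop) (f : set M)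
    : Prop :=
  (forall p, p \in f -> exists x y, D x /\ R y /\ p = <<x, y>>) /\
  (forall x, D x -> exists! y, <<x, y>> \in f).

(* Simpson's coding: <k, <m, n>> represents the finite set of all x < k such
   that m(x + 1) + 1 divides n. *)
Definition fin_mem (M : L2_structure) (x a : num M) : Prop :=
  exists k m n, a = <<k, <<m, n>>>> /\ x < k /\
    exists q, n = q * (m * (x + 1) + 1).

(* The code of a finite set is its least representative.  A number which is not
   of the form <k, <m, n>> has no [fin_mem]-elements, but it is not a code
   either since 0 = <0, <0, 0>> already represents the empty set. *)
Definition is_code (M : L2_structure) (a : num M) : Prop :=
  forall b, b < a -> ~ (forall x, fin_mem x b <-> fin_mem x a).

Record is_enumerable (M : L2_structure) (A : set M) : Prop := IsEnumerable {
  enum_function : is_function (fun _ : num M => True) (@is_code M) A;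
  enum_nondecreasing : forall m n a b : num M,
    m < n -> <<m, a>> \in A -> <<n, b>> \in A ->
    forall x, fin_mem x a -> fin_mem x b
}.

Definition enum_mem (M : L2_structure) (x : num M) (A : set M) : Prop :=
  exists n a, <<n, a>> \in A /\ fin_mem x a.

(** * Countable second-countable spaces *)

(* U_i is the section { x | <x, i> \in base } of a single set [base]. *)
Definition section (M : L2_structure) (base : set M) (i x : num M) : Prop :=
  <<x, i>> \in base.

Record csc_space (M : L2_structure) := CscSpace {
  points : set M;
  index : set M;
  base : set M;
  refinement : set M;
  base_sub : forall i x,
    i \in index -> section base i x -> x \in points;
  base_cover : forall x,
    x \in points -> exists i, i \in index /\ section base i x;
  refinement_function :
    is_function
      (fun p => exists x i j,
         x \in points /\ i \in index /\ j \in index /\ p = <<x, <<i, j>>>>)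
      (fun i => i \in index) refinement;
  refinement_spec : forall x i j k,
    x \in points -> i \in index -> j \in index ->
    section base i x -> section base j x ->
    <<<<x, <<i, j>>>>, k>> \in refinement ->
    section base k x /\
    (forall y, section base k y -> section base i y /\ section base j y)
}.

Section Properties.

Variables (M : L2_structure) (S : csc_space M).

Local Notation X := (points S).
Local Notation I := (index S).
Local Notation U := (section (base S)).

Definition covers (P : num M -> Prop) : Prop :=
  forall x, x \in X <-> exists i, P i /\ U i x.

Definition compact : Prop :=
  forall A : set M, is_enumerable A ->
    (forall i, enum_mem i A -> i \in I) ->
    covers (fun i => enum_mem i A) ->
    exists a, is_code a /\ (forall i, fin_mem i a -> enum_mem i A) /\
      covers (fun i => fin_mem i a).

Definition finite_subset_index (a : num M) : Prop :=
  is_code a /\ forall i, fin_mem i a -> i \in I.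

Definition has_finite_cover_relation : Prop :=
  exists C : set M,
    (forall a, a \in C -> finite_subset_index a) /\
    (forall a, finite_subset_index a ->
       (a \in C <-> covers (fun i => fin_mem i a))).

Definition effectively_compact : Prop :=
  compact /\ has_finite_cover_relation.

Definition discrete : Prop :=
  forall x, x \in X -> exists i, i \in I /\ forall y, U i y <-> y = x.

Definition effectively_discrete : Prop :=
  exists d : set M,
    is_function (fun x => x \in X) (fun i => i \in I) d /\
    forall x i, x \in X -> <<x, i>> \in d -> forall y, U i y <-> y = x.

Definition hausdorff : Prop :=
  forall x0 x1, x0 \in X -> x1 \in X -> x0 <> x1 ->
    exists i j, i \in I /\ j \in I /\ U i x0 /\ U j x1 /\
      forall y, ~ (U i y /\ U j y).

Definition effectively_hausdorff : Prop :=
  let XX p := exists x0 x1, x0 \in X /\ x1 \in X /\ p = <<x0, x1>> in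
  exists h0 h1 : set M,
    is_function XX (fun i => i \in I) h0 /\
    is_function XX (fun i => i \in I) h1 /\
    forall x0 x1 i j, x0 \in X -> x1 \in X -> x0 <> x1 ->
      <<<<x0, x1>>, i>> \in h0 -> <<<<x0, x1>>, j>> \in h1 ->
      U i x0 /\ U j x1 /\ forall y, ~ (U i y /\ U j y).

End Properties.

(** * The principles, as statements about a structure *)

Definition compact_effectively_compact (M : L2_structure) : Prop :=
  forall S : csc_space M, compact S -> effectively_compact S.

Definition discrete_effectively_discrete (M : L2_structure) : Prop :=
  forall S : csc_space M, discrete S -> effectively_discrete S.

Definition discrete_effcompact_effectively_discrete (M : L2_structure) : Prop :=
  forall S : csc_space M,
    discrete S -> effectively_compact S -> effectively_discrete S.

Definition hausdorff_effectively_hausdorff (M : L2_structure) : Prop :=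
  forall S : csc_space M, hausdorff S -> effectively_hausdorff S.

Definition hausdorff_effcompact_effectively_hausdorff (M : L2_structure)
    : Prop :=
  forall S : csc_space M,
    hausdorff S -> effectively_compact S -> effectively_hausdorff S.

(* Equivalence of two sentences modulo a theory: they hold in the same models
   of the theory. *)
Definition equivalent_over (T P Q : L2_structure -> Prop) : Prop :=
  forall M, T M -> (P M <-> Q M).

(* Main.v *)
(** Arithmetical comprehension is equivalent, over RCA_0, to the existence of
    all projections { n | exists m, <<n, m>> in R }; it yields the effective
    versions by choosing least witnesses.  For the converses, fix R.

    (1) Let V(x, s) consist of x and of all points which are not the least
    witness of x or of some n < s.  These sets form a basis, they are cofinite
    by strong Sigma^0_1 bounding, and hence the space is compact.  V(n, 0)
    alone covers the space iff n has no witness, or n is its own least witness;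
    so a finite cover relation computes the projection.

    (2'), (3') Let V(x, s) be {x} if searching below s settles correctly whether
    x has a witness, and otherwise add to x a final segment of the numbers,
    starting when the witness shows up.  An enumerable cover without a cofinite
    member lists a sufficient s for every x and hence computes the projection.
    So if the projection does not exist, the space is compact; it is discrete,
    and effective discreteness or separation would compute the projection. *)

From Stdlib Require Import Ring Classical FunctionalExtensionality.
Require Import Defs.

Set Implicit Arguments.
Unset Strict Implicit.
Unset Printing Implicit Defensive.

Local Open Scope L2_scope.

(** * Definability with parameters *)

Definition tail (T : Type) (e : nat -> T) (n : nat) : T := e (S n).

Lemma scons_tail (T : Type) (e : nat -> T) : scons (e O) (tail e) = e.
Proof. apply functional_extensionality; intros [|n]; reflexivity. Qed.

(** Reserving separate positions for variables and parameters lets parameter lists be merged without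
    renumbering the variables. *)
Fixpoint interleave (T : Type) (f g : nat -> T) (n : nat) : T :=
  match n with
  | O => f O
  | S O => g O
  | S (S m) => interleave (tail f) (tail g) m
  end.

Definition even_index (n : nat) : nat := Nat.add n n.
Definition odd_index (n : nat) : nat := S (Nat.add n n).

Lemma interleave_even (T : Type) (f g : nat -> T) n :
  interleave f g (even_index n) = f n.
Proof.
  revert f g; induction n as [|n IH]; intros f g; [reflexivity|].
  unfold even_index; simpl; rewrite PeanoNat.Nat.add_succ_r; apply IH.
Qed.

Lemma interleave_odd (T : Type) (f g : nat -> T) n :
  interleave f g (odd_index n) = g n.
Proof.
  revert f g; induction n as [|n IH]; intros f g; [reflexivity|].
  unfold odd_index; simpl; rewrite PeanoNat.Nat.add_succ_r; apply IH.
Qed.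

Lemma map_interleave (T T' : Type) (h : T -> T') (f g : nat -> T) n :
  h (interleave f g n) = interleave (fun k => h (f k)) (fun k => h (g k)) n.
Proof.
  (* The recursion advances two positions at a time, following [interleave]. *)
  revert f g n; fix IH 3; intros f g [|[|n]]; [reflexivity..|].
  apply (IH (tail f) (tail g) n).
Qed.

(** * Renaming of variables and its semantics *)

Fixpoint rename_term (r : nat -> nat) (t : term) : term :=
  match t with
  | TVar n => TVar (r n)
  | TZero => TZero
  | TOne => TOne
  | TAdd s t => TAdd (rename_term r s) (rename_term r t)
  | TMul s t => TMul (rename_term r s) (rename_term r t)
  end.

Definition lift_renaming (r : nat -> nat) : nat -> nat :=
  scons O (fun n => S (r n)).

Fixpoint rename (r q : nat -> nat) (A : formula) : formula :=
  match A with
  | FEq s t => FEq (rename_term r s) (rename_term r t)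
  | FLt s t => FLt (rename_term r s) (rename_term r t)
  | FMem t X => FMem (rename_term r t) (q X)
  | FNot A => FNot (rename r q A)
  | FAnd A B => FAnd (rename r q A) (rename r q B)
  | FOr A B => FOr (rename r q A) (rename r q B)
  | FImp A B => FImp (rename r q A) (rename r q B)
  | FBAll t A => FBAll (rename_term r t) (rename (lift_renaming r) q A)
  | FBEx t A => FBEx (rename_term r t) (rename (lift_renaming r) q A)
  | FAll A => FAll (rename (lift_renaming r) q A)
  | FEx A => FEx (rename (lift_renaming r) q A)
  | FAllSet A => FAllSet (rename r (lift_renaming q) A)
  | FExSet A => FExSet (rename r (lift_renaming q) A)
  end.

Lemma scons_lift (T : Type) (x : T) (e : nat -> T) (r : nat -> nat) :
  (fun n => scons x e (lift_renaming r n)) = scons x (fun n => e (r n)).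
Proof. apply functional_extensionality; intros [|n]; reflexivity. Qed.

(* [ar = false] stands for bounded formulas, [ar = true] for arithmetical
   ones. *)
Definition formula_class (ar : bool) (A : formula) : Prop :=
  if ar then arithmetical A else bounded A.

Lemma formula_class_rename ar r q A :
  formula_class ar A -> formula_class ar (rename r q A).
Proof.
  unfold formula_class; destruct ar; revert r q;
    induction A; simpl; intros r q H;
    try destruct H; try split; auto.
Qed.

Section Definability.

Context (M : L2_structure).

Lemma eval_rename (e : nat -> num M) r t :
  eval e (rename_term r t) = eval (fun n => e (r n)) t.
Proof. induction t; simpl; congruence. Qed.

Lemma sat_rename A : forall (e : nat -> num M) (E : nat -> set M) r q,
  sat e E (rename r q A) <-> sat (fun n => e (r n)) (fun n => E (q n)) A.
Proof.
  induction A; intros e E r q; simpl; rewrite ?eval_rename;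
    try (specialize (IHA1 e E r q); specialize (IHA2 e E r q); tauto);
    try reflexivity.
  - specialize (IHA e E r q); tauto.
  - setoid_rewrite IHA; setoid_rewrite scons_lift; reflexivity.
  - setoid_rewrite IHA; setoid_rewrite scons_lift; reflexivity.
  - setoid_rewrite IHA; setoid_rewrite scons_lift; reflexivity.
  - setoid_rewrite IHA; setoid_rewrite scons_lift; reflexivity.
  - setoid_rewrite IHA; setoid_rewrite scons_lift; reflexivity.
  - setoid_rewrite IHA; setoid_rewrite scons_lift; reflexivity.
Qed.

(* Number variables of the relation sit at the even positions, number
   parameters at the odd ones. *)
Definition definable (ar : bool) (P : (nat -> num M) -> Prop) : Prop :=
  exists A c E, formula_class ar A /\
    forall e, sat (interleave e c) E A <-> P e.

Definition term_definable (t : (nat -> num M) -> num M) : Prop :=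
  exists s c, forall e, eval (interleave e c) s = t e.

(** When two formulas are combined, their parameter lists [c] and [c'] become [interleave c c'];
    these renamings redirect each formula to its own half and leave the variables in place. *)
Definition left_params : nat -> nat :=
  interleave even_index (fun n => odd_index (even_index n)).
Definition right_params : nat -> nat :=
  interleave even_index (fun n => odd_index (odd_index n)).

Lemma interleave_left (e c c' : nat -> num M) :
  (fun n => interleave e (interleave c c') (left_params n)) = interleave e c.
Proof.
  apply functional_extensionality; intros n; unfold left_params.
  rewrite (map_interleave (interleave e (interleave c c'))); f_equal; apply functional_extensionality; intros k.
  - apply interleave_even.
  - rewrite interleave_odd; apply interleave_even.
Qed.

Lemma interleave_right (e c c' : nat -> num M) :
  (fun n => interleave e (interleave c c') (right_params n)) = interleave e c'.
Proof.
  apply functional_extensionality; intros n; unfold right_params.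
  rewrite (map_interleave (interleave e (interleave c c'))); f_equal; apply functional_extensionality; intros k.
  - apply interleave_even.
  - rewrite interleave_odd; apply interleave_odd.
Qed.

Lemma eval_left (e c c' : nat -> num M) t :
  eval (interleave e (interleave c c')) (rename_term left_params t)
  = eval (interleave e c) t.
Proof. rewrite eval_rename, interleave_left; reflexivity. Qed.

Lemma eval_right (e c c' : nat -> num M) t :
  eval (interleave e (interleave c c')) (rename_term right_params t)
  = eval (interleave e c') t.
Proof. rewrite eval_rename, interleave_right; reflexivity. Qed.

Lemma sat_left (e c c' : nat -> num M) (E E' : nat -> set M) A :
  sat (interleave e (interleave c c')) (interleave E E')
    (rename left_params even_index A) <-> sat (interleave e c) E A.
Proof.
  rewrite sat_rename, interleave_left.
  replace (fun n => interleave E E' (even_index n)) with E; [reflexivity|].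
  apply functional_extensionality; intros n; symmetry; apply interleave_even.
Qed.

Lemma sat_right (e c c' : nat -> num M) (E E' : nat -> set M) A :
  sat (interleave e (interleave c c')) (interleave E E')
    (rename right_params odd_index A) <-> sat (interleave e c') E' A.
Proof.
  rewrite sat_rename, interleave_right.
  replace (fun n => interleave E E' (odd_index n)) with E'; [reflexivity|].
  apply functional_extensionality; intros n; symmetry; apply interleave_odd.
Qed.

Lemma term_definable_var k : term_definable (fun e => e k).
Proof.
  exists (TVar (even_index k)), (fun _ => 0); intros e.
  apply interleave_even.
Qed.

Lemma term_definable_const a : term_definable (fun _ => a).
Proof. exists (TVar (odd_index O)), (fun _ => a); reflexivity. Qed.

Lemma term_definable_add s t :
  term_definable s -> term_definable t -> term_definable (fun e => s e + t e).
Proof.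
  intros (s' & c & Hs) (t' & d & Ht).
  exists (TAdd (rename_term left_params s') (rename_term right_params t')),
    (interleave c d); intros e; simpl.
  rewrite eval_left, eval_right; congruence.
Qed.

Lemma term_definable_mul s t :
  term_definable s -> term_definable t -> term_definable (fun e => s e * t e).
Proof.
  intros (s' & c & Hs) (t' & d & Ht).
  exists (TMul (rename_term left_params s') (rename_term right_params t')),
    (interleave c d); intros e; simpl.
  rewrite eval_left, eval_right; congruence.
Qed.

Lemma term_definable_pair s t :
  term_definable s -> term_definable t ->
  term_definable (fun e => << s e, t e >>).
Proof.
  intros Hs Ht; unfold code_pair.
  repeat (apply term_definable_add || apply term_definable_mul); assumption.
Qed.

Lemma definable_ext ar P Q :
  (forall e, P e <-> Q e) -> definable ar P -> definable ar Q.
Proof.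
  intros HPQ (A & c & E & HA & H); exists A, c, E; split; [exact HA|].
  intros e; rewrite H; apply HPQ.
Qed.

Lemma some_set : exists E : nat -> set M, True.
Proof. destruct (set_inhabited M) as [X]; exists (fun _ => X); exact I. Qed.

Lemma definable_eq ar s t :
  term_definable s -> term_definable t -> definable ar (fun e => s e = t e).
Proof.
  intros (s' & c & Hs) (t' & d & Ht); destruct some_set as [E _].
  exists (FEq (rename_term left_params s') (rename_term right_params t')),
    (interleave c d), E; split; [destruct ar; exact I|].
  intros e; simpl; rewrite eval_left, eval_right, Hs, Ht; reflexivity.
Qed.

Lemma definable_lt ar s t :
  term_definable s -> term_definable t -> definable ar (fun e => s e < t e).
Proof.
  intros (s' & c & Hs) (t' & d & Ht); destruct some_set as [E _].
  exists (FLt (rename_term left_params s') (rename_term right_params t')),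
    (interleave c d), E; split; [destruct ar; exact I|].
  intros e; simpl; rewrite eval_left, eval_right, Hs, Ht; reflexivity.
Qed.

Lemma definable_mem ar t X :
  term_definable t -> definable ar (fun e => t e \in X).
Proof.
  intros (t' & c & Ht); exists (FMem t' O), c, (fun _ => X).
  split; [destruct ar; exact I|].
  intros e; simpl; rewrite Ht; reflexivity.
Qed.

Lemma definable_not ar P : definable ar P -> definable ar (fun e => ~ P e).
Proof.
  intros (A & c & E & HA & H); exists (FNot A), c, E.
  split; [destruct ar; exact HA|].
  intros e; simpl; rewrite H; reflexivity.
Qed.

Lemma definable_and ar P Q :
  definable ar P -> definable ar Q -> definable ar (fun e => P e /\ Q e).
Proof.
  intros (A & c & E & HA & HP) (B & d & F & HB & HQ).
  exists (FAnd (rename left_params even_index A)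
            (rename right_params odd_index B)),
    (interleave c d), (interleave E F); split.
  - apply (formula_class_rename left_params even_index) in HA.
    apply (formula_class_rename right_params odd_index) in HB.
    destruct ar; split; assumption.
  - intros e; simpl; rewrite sat_left, sat_right, HP, HQ; reflexivity.
Qed.

Lemma definable_imp ar P Q :
  definable ar P -> definable ar Q -> definable ar (fun e => P e -> Q e).
Proof.
  intros HP HQ; apply definable_ext with (fun e => ~ (P e /\ ~ Q e)).
  - intros e; split; [intros H HPe; apply NNPP|]; tauto.
  - apply definable_not, definable_and; [|apply definable_not]; assumption.
Qed.

Lemma definable_or ar P Q :
  definable ar P -> definable ar Q -> definable ar (fun e => P e \/ Q e).
Proof.
  intros HP HQ; apply definable_ext with (fun e => ~ P e -> Q e).
  - intros e; destruct (classic (P e)); tauto.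
  - apply definable_imp; [apply definable_not|]; assumption.
Qed.

Lemma definable_iff ar P Q :
  definable ar P -> definable ar Q -> definable ar (fun e => P e <-> Q e).
Proof.
  intros HP HQ; unfold iff.
  apply definable_and; apply definable_imp; assumption.
Qed.

(** Classically a proposition independent of the assignment is equivalent to [0 = 0] or to its
    negation, so it may be any statement of the metatheory. *)
Lemma definable_prop ar (p : Prop) : definable ar (fun _ => p).
Proof.
  assert (H : definable ar (fun _ => 0 = 0 :> num M))
    by (apply definable_eq; apply term_definable_const).
  destruct (classic p) as [Hp|Hp].
  - apply definable_ext with (2 := H); tauto.
  - apply definable_ext with (2 := definable_not H); tauto.
Qed.

Lemma definable_rename ar r P :
  definable ar P -> definable ar (fun e => P (fun n => e (r n))).
Proof.
  intros (A & c & E & HA & H).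
  exists (rename (interleave (fun n => even_index (r n)) odd_index)
            (fun n => n) A), c, E.
  split; [apply formula_class_rename, HA|].
  intros e; rewrite sat_rename, <- H; simpl.
  replace (fun n => interleave e c
    (interleave (fun n => even_index (r n)) odd_index n))
    with (interleave (fun n => e (r n)) c); [reflexivity|].
  apply functional_extensionality; intros n.
  rewrite (map_interleave (interleave e c)).
  f_equal; apply functional_extensionality; intros k; symmetry.
  - apply interleave_even.
  - apply interleave_odd.
Qed.

(** A quantifier puts its value in front of the whole interleaved assignment; this renaming treats
    that value as variable 0 of the relation and shifts the remaining variables, but not the
    parameters. *)
Definition push_param : nat -> nat :=
  interleave (scons O (fun n => S (even_index n))) (fun n => S (odd_index n)).

Lemma sat_push x (e c : nat -> num M) E A :
  sat (scons x (interleave e c)) E (rename push_param (fun n => n) A)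
  <-> sat (interleave (scons x e) c) E A.
Proof.
  rewrite sat_rename; simpl.
  replace (fun n => scons x (interleave e c) (push_param n))
    with (interleave (scons x e) c); [reflexivity|].
  apply functional_extensionality; intros n; unfold push_param.
  rewrite (map_interleave (scons x (interleave e c))); f_equal;
    apply functional_extensionality.
  - intros [|k]; symmetry; [reflexivity|exact (interleave_even e c k)].
  - intros k; symmetry; exact (interleave_odd e c k).
Qed.

Lemma definable_bex ar t (Q : (nat -> num M) -> num M -> Prop) :
  term_definable t -> definable ar (fun e => Q (tail e) (e O)) ->
  definable ar (fun e => exists x, x < t e /\ Q e x).
Proof.
  intros (t' & c & Ht) (A & d & E & HA & H).
  exists (FBEx (rename_term left_params t')
    (rename push_param (fun n => n) (rename right_params odd_index A))),
    (interleave c d), (interleave E E); split.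
  - apply (formula_class_rename right_params odd_index) in HA.
    apply (formula_class_rename push_param (fun n => n)) in HA.
    destruct ar; assumption.
  - intros e; simpl; rewrite eval_left, Ht.
    setoid_rewrite sat_push; setoid_rewrite sat_right; setoid_rewrite H.
    reflexivity.
Qed.

Lemma definable_ball ar t (Q : (nat -> num M) -> num M -> Prop) :
  term_definable t -> definable ar (fun e => Q (tail e) (e O)) ->
  definable ar (fun e => forall x, x < t e -> Q e x).
Proof.
  intros Ht HQ.
  apply definable_ext with (fun e => ~ exists x, x < t e /\ ~ Q e x).
  - intros e; split.
    + intros H x Hx; apply NNPP; intros Hn; apply H; eauto.
    + intros H (x & Hx & Hn); auto.
  - apply definable_not, definable_bex; [exact Ht|apply definable_not, HQ].
Qed.

Lemma definable_ex (Q : (nat -> num M) -> num M -> Prop) :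
  definable true (fun e => Q (tail e) (e O)) ->
  definable true (fun e => exists x, Q e x).
Proof.
  intros (A & d & E & HA & H).
  exists (FEx (rename push_param (fun n => n) A)), d, E; split.
  - apply (formula_class_rename push_param (fun n => n)) in HA; exact HA.
  - intros e; simpl; setoid_rewrite sat_push; setoid_rewrite H; reflexivity.
Qed.

Lemma definable_all (Q : (nat -> num M) -> num M -> Prop) :
  definable true (fun e => Q (tail e) (e O)) ->
  definable true (fun e => forall x, Q e x).
Proof.
  intros HQ; apply definable_ext with (fun e => ~ exists x, ~ Q e x).
  - intros e; split.
    + intros H x; apply NNPP; intros Hn; apply H; eauto.
    + intros H (x & Hn); auto.
  - apply definable_not, definable_ex, definable_not, HQ.
Qed.

(** * Dependence on finitely many variables *)

Definition agree (N : nat) (e e' : nat -> num M) : Prop :=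
  forall n, Peano.lt n N -> e n = e' n.

Lemma agree_max N1 N2 e e' :
  agree (Nat.max N1 N2) e e' -> agree N1 e e' /\ agree N2 e e'.
Proof.
  intros H; split; intros n Hn; apply H;
    eapply PeanoNat.Nat.lt_le_trans; eauto using PeanoNat.Nat.le_max_l,
      PeanoNat.Nat.le_max_r.
Qed.

Lemma agree_scons N x e e' : agree N e e' -> agree N (scons x e) (scons x e').
Proof.
  intros H [|n] Hn; [reflexivity|].
  apply H, PeanoNat.Nat.lt_succ_l, Hn.
Qed.

Lemma eval_agree t : exists N, forall e e',
  agree N e e' -> eval e t = eval e' t.
Proof.
  induction t as [n| | |s [N1 IH1] t [N2 IH2]|s [N1 IH1] t [N2 IH2]].
  - exists (S n); intros e e' H; apply H, PeanoNat.Nat.lt_succ_diag_r.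
  - exists O; reflexivity.
  - exists O; reflexivity.
  - exists (Nat.max N1 N2); intros e e' H; apply agree_max in H as [H1 H2].
    simpl; rewrite (IH1 _ _ H1), (IH2 _ _ H2); reflexivity.
  - exists (Nat.max N1 N2); intros e e' H; apply agree_max in H as [H1 H2].
    simpl; rewrite (IH1 _ _ H1), (IH2 _ _ H2); reflexivity.
Qed.

(** The bound for the body also serves a quantifier, since prefixing the same value to both
    assignments preserves agreement below [N]. *)
Lemma sat_agree A : exists N, forall e e' E,
  agree N e e' -> (sat e E A <-> sat e' E A).
Proof.
  induction A as [s t|s t|t X|A [N IH]|A [N1 IH1] B [N2 IH2]
    |A [N1 IH1] B [N2 IH2]|A [N1 IH1] B [N2 IH2]|t A [N IH]|t A [N IH]
    |A [N IH]|A [N IH]|A [N IH]|A [N IH]].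
  1,2: destruct (eval_agree s) as [N1 H1], (eval_agree t) as [N2 H2];
    exists (Nat.max N1 N2); intros e e' E H; apply agree_max in H as [Hs Ht];
    simpl; rewrite (H1 _ _ Hs), (H2 _ _ Ht); reflexivity.
  1: destruct (eval_agree t) as [N H1]; exists N; intros e e' E H; simpl;
    rewrite (H1 _ _ H); reflexivity.
  1: exists N; intros e e' E H; simpl; rewrite (IH _ _ E H); reflexivity.
  1,2,3: exists (Nat.max N1 N2); intros e e' E H; apply agree_max in H as [Ha Hb];
    simpl; rewrite (IH1 _ _ E Ha), (IH2 _ _ E Hb); reflexivity.
  1,2: destruct (eval_agree t) as [N1 H1]; exists (Nat.max N1 N);
    intros e e' E H; apply agree_max in H as [Ha Hb]; simpl;
    rewrite (H1 _ _ Ha);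
    setoid_rewrite (fun x => IH _ _ E (agree_scons x Hb));
    reflexivity.
  1,2: exists N; intros e e' E H; simpl;
    setoid_rewrite (fun x => IH _ _ E (agree_scons x H)); reflexivity.
  1,2: exists N; intros e e' E H; simpl;
    setoid_rewrite (fun X => IH _ _ (scons X E) H); reflexivity.
Qed.

Lemma agree_interleave N e e' c :
  agree N e e' -> agree N (interleave e c) (interleave e' c).
Proof.
  assert (H : forall n e e' c, agree (S n) e e' ->
    interleave e c n = interleave e' c n :> num M).
  { fix IH 1; intros [|[|n]] f f' d H.
    - apply H, PeanoNat.Nat.lt_succ_diag_r.
    - reflexivity.
    - apply (IH n (tail f) (tail f') (tail d)); intros k Hk.
      apply H; apply -> PeanoNat.Nat.succ_lt_mono.
      apply PeanoNat.Nat.lt_lt_succ_r, Hk. }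
  intros He n Hn; apply H; intros k Hk; apply He.
  eapply PeanoNat.Nat.le_lt_trans; [apply -> PeanoNat.Nat.lt_succ_r; exact Hk|].
  exact Hn.
Qed.

(** This finite bound on the relevant variables is what the later induction on the number of
    variables starts from. *)
Lemma definable_agree ar P : definable ar P ->
  exists N, forall e e', agree N e e' -> (P e <-> P e').
Proof.
  intros (A & c & E & _ & H); destruct (sat_agree A) as [N HN]; exists N.
  intros e e' He; rewrite <- !H; apply HN, agree_interleave, He.
Qed.

End Definability.

Lemma term_definable_rename (M : L2_structure) (t : (nat -> num M) -> num M) r :
  term_definable t -> term_definable (fun e => t (fun n => e (r n))).
Proof.
  intros (s & c & H).
  exists (rename_term
    (interleave (fun n => even_index (r n)) odd_index) s), c.
  intros e; rewrite eval_rename, <- H; f_equal.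
  apply functional_extensionality; intros n.
  rewrite (map_interleave (interleave e c)).
  f_equal; apply functional_extensionality; intros k.
  - apply interleave_even.
  - apply interleave_odd.
Qed.

(** Closure under substitution of terms is built in, so that a hypothesis of this form applies
    directly to any instance of [P]. *)
Definition definable1 (M : L2_structure) (ar : bool) (P : num M -> Prop)
    : Prop :=
  forall t, term_definable t -> definable ar (fun e => P (t e)).

Definition definable2 (M : L2_structure) (ar : bool)
    (R : num M -> num M -> Prop) : Prop :=
  forall s t, term_definable s -> term_definable t ->
    definable ar (fun e => R (s e) (t e)).

Definition definable3 (M : L2_structure) (ar : bool)
    (R : num M -> num M -> num M -> Prop) : Prop :=
  forall s t u, term_definable s -> term_definable t -> term_definable u ->
    definable ar (fun e => R (s e) (t e) (u e)).

Ltac term_definable :=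
  cbv beta delta [tail];
  first
    [ assumption
    | apply term_definable_var
    | apply term_definable_const
    | apply term_definable_add; term_definable
    | apply term_definable_mul; term_definable
    | apply term_definable_pair; term_definable
    | progress apply term_definable_rename; term_definable ].

(** A hook, redefined each time a further predicate has been shown definable. *)
Ltac definable_derived := fail.

(** Bounded quantifiers are tried before conjunctions, implications and unbounded quantifiers, so
    that their bounds are recognised. The last case absorbs parts independent of the assignment. *)
Ltac definable :=
  cbv beta delta [tail section];
  first
    [ assumption
    | match goal with
      | H : definable1 _ _ |- _ => apply H; term_definable
      | H : definable2 _ _ |- _ => apply H; term_definable
      | H : definable3 _ _ |- _ => apply H; term_definable
      end
    | definable_derived
    | apply definable_eq; term_definable
    | apply definable_lt; term_definable
    | apply definable_mem; term_definable
    | apply definable_not; definable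
    | apply definable_bex; [term_definable | definable]
    | apply definable_ball; [term_definable | definable]
    | apply definable_and; definable
    | apply definable_or; definable
    | apply definable_iff; definable
    | apply definable_ex; definable
    | apply definable_all; definable
    | apply definable_imp; definable
    | apply definable_prop ].

(** * Consequences of the schemes of RCA_0 *)

Definition sigma1 (M : L2_structure) (P : (nat -> num M) -> Prop) : Prop :=
  exists Q : (nat -> num M) -> num M -> Prop,
    definable false (fun e => Q (tail e) (e O)) /\
    forall e, P e <-> exists x, Q e x.

Lemma sigma1_ext (M : L2_structure) (P Q : (nat -> num M) -> Prop) :
  (forall e, P e <-> Q e) -> sigma1 P -> sigma1 Q.
Proof.
  intros HPQ (R & HR & H); exists R; split; [exact HR|].
  intros e; rewrite <- HPQ; apply H.
Qed.

Lemma sigma1_definable (M : L2_structure) (P : (nat -> num M) -> Prop) :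
  definable false P -> sigma1 P.
Proof.
  intros HP; exists (fun e _ => P e); split.
  - exact (definable_rename S HP).
  - intros e; split; [exists 0; assumption|intros [_ H]; exact H].
Qed.

Lemma sigma1_ex_definable (M : L2_structure)
    (Q : (nat -> num M) -> num M -> Prop) :
  definable false (fun e => Q (tail e) (e O)) ->
  sigma1 (fun e => exists x, Q e x).
Proof. intros HQ; exists Q; split; [exact HQ|reflexivity]. Qed.

Lemma sigma1_and_definable (M : L2_structure) (P Q : (nat -> num M) -> Prop) :
  definable false P -> sigma1 Q -> sigma1 (fun e => P e /\ Q e).
Proof.
  intros HP (R & HR & H); exists (fun e x => P e /\ R e x); split.
  - apply definable_and; [exact (definable_rename S HP)|exact HR].
  - intros e; rewrite H; firstorder.
Qed.

Lemma sigma1_rename (M : L2_structure) r (P : (nat -> num M) -> Prop) :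
  sigma1 P -> sigma1 (fun e => P (fun n => e (r n))).
Proof.
  intros (Q & HQ & H); exists (fun e x => Q (fun n => e (r n)) x); split.
  - exact (definable_rename (lift_renaming r) HQ).
  - intros e; apply H.
Qed.

Lemma sigma1_agree (M : L2_structure) (P : (nat -> num M) -> Prop) :
  sigma1 P -> exists N, forall e e', agree N e e' -> (P e <-> P e').
Proof.
  intros (Q & HQ & H); destruct (definable_agree HQ) as [N HN]; exists N.
  intros e e' He; rewrite !H.
  assert (HQx : forall x, Q e x <-> Q e' x).
  { intros x; exact (HN (scons x e) (scons x e') (agree_scons x He)). }
  firstorder.
Qed.

Lemma Sigma01_rename r q A : Sigma01 A -> Sigma01 (rename r q A).
Proof.
  intros (B & HB & ->); eexists; split; [|reflexivity].
  exact (formula_class_rename (ar := false) _ _ HB).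
Qed.

Lemma sigma1_formula (M : L2_structure) (P : (nat -> num M) -> Prop) :
  sigma1 P -> exists A c E, Sigma01 A /\
    forall e, sat (interleave e c) E A <-> P e.
Proof.
  intros (Q & (A & c & E & HA & H) & HQ).
  exists (FEx (rename push_param (fun n => n) A)), c, E; split.
  - eexists; split; [|reflexivity].
    exact (formula_class_rename (ar := false) _ _ HA).
  - intros e; simpl; rewrite HQ.
    setoid_rewrite sat_push; setoid_rewrite H; reflexivity.
Qed.

Section Schemes.

Context (M : L2_structure) (HM : RCA0 M).

Lemma sigma1_induction (P : num M -> Prop) :
  sigma1 (fun e => P (e O)) ->
  P 0 -> (forall n, P n -> P (n + 1)) -> forall n, P n.
Proof.
  intros HP H0 HS n.
  destruct (sigma1_formula HP) as (A & c & E & HA & H).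
  assert (HA' := Sigma01_rename push_param (fun n => n) HA).
  assert (Hn : forall n, sat (scons n (interleave (fun _ => 0) c)) E
    (rename push_param (fun n => n) A) <-> P n).
  { intros k; rewrite sat_push, H; reflexivity. }
  apply Hn, (RCA0_induction HM HA').
  - apply Hn, H0.
  - intros k Hk; apply Hn, HS, Hn, Hk.
Qed.

(** The scheme asks for a Pi^0_1 formula equivalent to the Sigma^0_1 one; negating the matrix of a
    Sigma^0_1 definition of the complement supplies it. *)
Lemma delta1_comprehension (P : num M -> Prop) :
  sigma1 (fun e => P (e O)) -> sigma1 (fun e => ~ P (e O)) ->
  exists X : set M, forall n, n \in X <-> P n.
Proof.
  intros HP HN.
  destruct (sigma1_formula HP) as (A & c & E & HA & H).
  destruct (sigma1_formula HN) as (B & d & F & HB & HnB).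
  apply (Sigma01_rename left_params even_index) in HA.
  apply (Sigma01_rename push_param (fun n => n)) in HA.
  apply (Sigma01_rename right_params odd_index) in HB.
  apply (Sigma01_rename push_param (fun n => n)) in HB.
  destruct HB as (C & HC & HBC).
  assert (Hpi : Pi01 (FAll (FNot C))) by (exists (FNot C); split; [exact HC|reflexivity]).
  destruct (RCA0_comprehension HM HA Hpi
    (e := interleave (fun _ => 0) (interleave c d)) (E := interleave E F))
    as [X HX].
  - intros n; rewrite sat_push, sat_left, H.
    assert (HCn : sat (scons n (interleave (fun _ => 0) (interleave c d)))
      (interleave E F) (FEx C) <-> ~ P n).
    { rewrite <- HBC, sat_push, sat_right, HnB; reflexivity. }
    simpl in *; split.
    + intros HPn x Hx; apply HCn; eauto.
    + intros Hall; apply NNPP; intros HPn.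
      apply HCn in HPn as [x Hx]; exact (Hall x Hx).
  - exists X; intros n; rewrite HX, sat_push, sat_left, H; reflexivity.
Qed.

Lemma definable_comprehension (P : num M -> Prop) :
  definable false (fun e => P (e O)) ->
  exists X : set M, forall n, n \in X <-> P n.
Proof.
  intros HP; apply delta1_comprehension; apply sigma1_definable;
    [|apply definable_not]; exact HP.
Qed.

Lemma definable_induction (P : num M -> Prop) :
  definable false (fun e => P (e O)) ->
  P 0 -> (forall n, P n -> P (n + 1)) -> forall n, P n.
Proof. intros HP; apply sigma1_induction, sigma1_definable, HP. Qed.

End Schemes.

(** * Arithmetic in a model of RCA_0 *)

Ltac sigma1_induct n :=
  revert n;
  match goal with
  | HM : RCA0 _ |- forall n, @?P n =>
      apply (sigma1_induction HM (P := P)); cbv beta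
  end.

Ltac induct n :=
  revert n;
  match goal with
  | HM : RCA0 _ |- forall n, @?P n =>
      apply (definable_induction HM (P := P)); cbv beta; [definable|..]
  end.

(** * Semiring laws and the order, by induction inside the model *)

Section Semiring.

Context (M : L2_structure) (HM : RCA0 M).

Let B := RCA0_basic HM.

Lemma num_add_0_l (a : num M) : 0 + a = a.
Proof.
  induct a; [apply (add_0 B)|].
  intros n H; rewrite (add_succ B), H; reflexivity.
Qed.

Lemma num_add_assoc (a b c : num M) : a + (b + c) = (a + b) + c.
Proof.
  induct c; [rewrite !(add_0 B); reflexivity|].
  intros n H; rewrite !(add_succ B), H; reflexivity.
Qed.

Lemma num_succ_add (a b : num M) : (a + 1) + b = (a + b) + 1.
Proof.
  induct b; [rewrite !(add_0 B); reflexivity|].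
  intros n H; rewrite !(add_succ B), H; reflexivity.
Qed.

Lemma num_add_comm (a b : num M) : a + b = b + a.
Proof.
  induct b; [rewrite (add_0 B), num_add_0_l; reflexivity|].
  intros n H; rewrite (add_succ B), H, num_succ_add; reflexivity.
Qed.

Lemma num_mul_0_l (a : num M) : 0 * a = 0.
Proof.
  induct a; [apply (mul_0 B)|].
  intros n H; rewrite (mul_succ B), H, (add_0 B); reflexivity.
Qed.

Lemma num_succ_mul (a b : num M) : (a + 1) * b = a * b + b.
Proof.
  induct b; [rewrite !(mul_0 B), (add_0 B); reflexivity|].
  intros n H; rewrite !(mul_succ B), H, <- !num_add_assoc; f_equal.
  rewrite !(add_succ B), (num_add_comm n a); reflexivity.
Qed.

Lemma num_mul_comm (a b : num M) : a * b = b * a.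
Proof.
  induct b; [rewrite (mul_0 B), num_mul_0_l; reflexivity|].
  intros n H; rewrite (mul_succ B), num_succ_mul, H; reflexivity.
Qed.

Lemma num_mul_1_l (a : num M) : 1 * a = a.
Proof.
  rewrite <- (num_add_0_l 1), num_succ_mul, num_mul_0_l; apply num_add_0_l.
Qed.

Lemma num_mul_add_r (a b c : num M) : (a + b) * c = a * c + b * c.
Proof.
  induct c; [rewrite !(mul_0 B), (add_0 B); reflexivity|].
  intros n H; rewrite !(mul_succ B), H, <- !num_add_assoc; f_equal.
  rewrite !num_add_assoc, (num_add_comm (b * n) a); reflexivity.
Qed.

Lemma num_mul_assoc (a b c : num M) : a * (b * c) = (a * b) * c.
Proof.
  induct c; [rewrite !(mul_0 B); reflexivity|].
  intros n H; rewrite !(mul_succ B), <- H.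
  rewrite (num_mul_comm a (b * n + b)), num_mul_add_r.
  rewrite (num_mul_comm (b * n)), (num_mul_comm b a); reflexivity.
Qed.

Lemma num_semiring :
  semi_ring_theory (0 : num M) 1 (@add M) (@mul M) eq.
Proof.
  constructor; auto using num_add_0_l, num_add_comm, num_add_assoc,
    num_mul_1_l, num_mul_0_l, num_mul_comm, num_mul_assoc, num_mul_add_r.
Qed.

Add Ring num_ring : num_semiring.

Lemma num_add_cancel_r (a b c : num M) : a + c = b + c -> a = b.
Proof.
  induct c; [rewrite !(add_0 B); auto|].
  intros n IH H; apply IH; rewrite !(add_succ B) in H.
  exact (succ_inj B H).
Qed.

Lemma num_add_cancel_l (a b c : num M) : c + a = c + b -> a = b.
Proof. rewrite !(num_add_comm c); apply num_add_cancel_r. Qed.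

Lemma num_case (a : num M) : a = 0 \/ exists b, a = b + 1.
Proof.
  (* Pulling the quantifier in front of the disjunction puts the claim in Sigma^0_1 form, as
     induction requires. *)
  enough (H : exists b, a = 0 \/ a = b + 1) by firstorder.
  sigma1_induct a.
  - apply sigma1_ex_definable; definable.
  - exists 0; auto.
  - intros n _; exists n; auto.
Qed.

(** The order is primitive; naming the difference turns inequalities into equations within reach of
    [ring]. The tactic [lt_by] performs the converse passage. *)
Lemma num_lt_elim (x y : num M) : x < y -> exists z, y = x + z + 1.
Proof.
  enough (H : exists z, x < y -> y = x + z + 1) by firstorder.
  sigma1_induct y.
  - apply sigma1_ex_definable; definable.
  - exists 0; intros H; destruct (nlt_0 B H).
  - intros n [z Hz]; destruct (classic (x < n)) as [H|H].
    + exists (z + 1); intros _; rewrite (Hz H); ring.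
    + exists 0; intros Hn; apply (lt_succ B) in Hn as [Hn|Hn]; [tauto|].
      rewrite Hn; ring.
Qed.

Lemma num_lt_intro (x z : num M) : x < x + z + 1.
Proof.
  induct z; [apply (lt_succ B); right; ring|].
  intros n H; apply (lt_succ B); left.
  replace (x + (n + 1)) with (x + n + 1) by ring; exact H.
Qed.

Lemma num_lt_irrefl (x : num M) : ~ x < x.
Proof.
  intros H; apply num_lt_elim in H as [z H].
  apply (succ_neq0 B (n := z)), (num_add_cancel_l (c := x)).
  rewrite num_add_assoc, <- H; ring.
Qed.

Lemma num_lt_trans (x y z : num M) : x < y -> y < z -> x < z.
Proof.
  intros Hx Hy; apply num_lt_elim in Hx as [a ->], Hy as [b ->].
  replace (x + a + 1 + b + 1) with (x + (a + b + 1) + 1) by ring.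
  apply num_lt_intro.
Qed.

(** The weak inequality is written [x < y + 1] throughout. *)
Lemma num_le_elim (x y : num M) : x < y + 1 -> exists z, y = x + z.
Proof.
  intros H; apply num_lt_elim in H as [z H]; exists z.
  exact (succ_inj B H).
Qed.

Lemma num_compare (x y : num M) : (exists z, y = x + z) \/ (exists z, x = y + z + 1).
Proof.
  enough (H : exists z, y = x + z \/ x = y + z + 1) by firstorder.
  sigma1_induct y.
  - apply sigma1_ex_definable; definable.
  - destruct (num_case x) as [->|[b ->]]; [exists 0|exists b]; [left|right]; ring.
  - intros n [z [->| ->]].
    + exists (z + 1); left; ring.
    + destruct (num_case z) as [->|[w ->]]; [exists 0; left|exists w; right]; ring.
Qed.

End Semiring.

Ltac lt_by z :=
  match goal with
  | HM : RCA0 _ |- ?x < ?y =>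
      replace y with (x + z + 1) by ring; apply (num_lt_intro HM)
  end.

Definition divides (M : L2_structure) (d a : num M) : Prop :=
  exists q, a = q * d.

Section Numbers.

Context (M : L2_structure) (HM : RCA0 M).

Let B := RCA0_basic HM.

Add Ring num_ring : (num_semiring HM).

Lemma num_neq_add_succ (x z : num M) : x <> x + z + 1.
Proof.
  intros H; apply (num_lt_irrefl HM (x := x)); rewrite H at 2.
  apply (num_lt_intro HM).
Qed.

Lemma num_add_eq_0 (x y : num M) : x + y = 0 -> x = 0 /\ y = 0.
Proof.
  intros H; destruct (num_case HM y) as [->|[z ->]].
  - split; [rewrite <- H; ring|reflexivity].
  - destruct (succ_neq0 B (n := x + z)); rewrite <- H; ring.
Qed.

Lemma num_mul_neq0 (x y : num M) : x <> 0 -> y <> 0 -> x * y <> 0.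
Proof.
  intros Hx Hy; destruct (num_case HM x) as [->|[a ->]]; [tauto|].
  destruct (num_case HM y) as [->|[b ->]]; [tauto|].
  replace ((a + 1) * (b + 1)) with (a * b + a + b + 1) by ring.
  apply (succ_neq0 B).
Qed.

Lemma num_lt_succ_diag (x : num M) : x < x + 1.
Proof. lt_by (0 : num M). Qed.

Lemma num_lt_or_ge (x y : num M) : x < y \/ y < x + 1.
Proof.
  destruct (num_compare HM y x) as [[z ->]|[z ->]].
  - right; lt_by z.
  - left; lt_by z.
Qed.

Lemma num_lt_total (x y : num M) : x <> y -> x < y \/ y < x.
Proof.
  intros H; destruct (num_lt_or_ge x y) as [Hlt|Hge]; [auto|].
  apply (lt_succ B) in Hge as [Hge|Hge]; [auto|congruence].
Qed.

Lemma num_not_lt_ge (x y : num M) : x < y -> ~ y < x + 1.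
Proof.
  intros Hx Hy; apply (num_lt_elim HM) in Hx as [a ->].
  apply (num_le_elim HM) in Hy as [b H].
  apply (num_neq_add_succ (x := x) (z := a + b)); rewrite H at 1; ring.
Qed.

Lemma num_le_lt_trans (x y z : num M) : x < y + 1 -> y < z -> x < z.
Proof.
  intros Hx Hy; apply (lt_succ B) in Hx as [Hx| ->]; [|exact Hy].
  exact (num_lt_trans HM Hx Hy).
Qed.

Lemma num_lt_le_trans (x y z : num M) : x < y -> y < z + 1 -> x < z.
Proof.
  intros Hx Hy; apply (lt_succ B) in Hy as [Hy| <-]; [|exact Hx].
  exact (num_lt_trans HM Hx Hy).
Qed.

Lemma num_lt_add_l (x y z : num M) : x < y -> x < z + y.
Proof.
  intros H; apply (num_lt_elim HM) in H as [a ->]; lt_by (z + a).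
Qed.

Lemma num_lt_add_r (x y z : num M) : x < y -> x < y + z.
Proof.
  intros H; apply (num_lt_elim HM) in H as [a ->]; lt_by (z + a).
Qed.

(** With [s = i + j] the code lies between [s * s] and [s * s + s], hence below the square of
    [s + 1]. It therefore determines [s], then [i], then [j]. *)
Lemma code_pair_inj (i j i' j' : num M) :
  << i, j >> = << i', j' >> -> i = i' /\ j = j'.
Proof.
  assert (Hlt : forall i j i' j' z : num M,
    i' + j' = i + j + z + 1 -> << i, j >> <> << i', j' >>).
  { clear - HM; intros i j i' j' z Hs H; unfold code_pair in H; rewrite Hs in H.
    (* The chosen [z] is the expanded difference of the two codes, less one. *)
    apply (num_neq_add_succ (x := (i + j) * (i + j) + i)
      (z := i + (1 + 1) * i * z + (1 + 1) * j * (z + 1) + z * z + (1 + 1) * z + i')).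
    rewrite H at 1; ring. }
  intros H; destruct (num_compare HM (i + j) (i' + j')) as [[z Hz]|[z Hz]].
  - destruct (num_case HM z) as [->|[w ->]].
    + assert (Hs : i' + j' = i + j) by (rewrite Hz; ring).
      unfold code_pair in H; rewrite Hs in H.
      apply (num_add_cancel_l HM) in H; subst i'.
      split; [reflexivity|]; symmetry; exact (num_add_cancel_l HM Hs).
    + destruct (Hlt i j i' j' w); [rewrite Hz; ring|exact H].
  - destruct (Hlt i' j' i j z Hz); symmetry; exact H.
Qed.

Lemma code_pair_fst (i j : num M) : i < << i, j >> + 1.
Proof. unfold code_pair; lt_by ((i + j) * (i + j)). Qed.

Lemma code_pair_snd (i j : num M) : j < << i, j >> + 1.
Proof.
  unfold code_pair; destruct (num_case HM j) as [->|[z ->]].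
  - lt_by ((i + 0) * (i + 0) + i).
  - lt_by (i + (i + z) * (i + (z + 1)) + i).
Qed.

(** Two unbounded quantifiers merge into one over a common bound of both witnesses, for instance
    their sum. *)
Lemma sigma1_ex (Q : (nat -> num M) -> num M -> Prop) :
  sigma1 (fun e => Q (tail e) (e O)) -> sigma1 (fun e => exists x, Q e x).
Proof.
  intros (R & HR & H).
  assert (HQ : forall e x, Q e x <-> exists y, R (scons x e) y)
    by (intros e x; exact (H (scons x e))).
  exists (fun e z => exists x, x < z + 1 /\ exists y, y < z + 1 /\
    R (scons x e) y); split.
  - apply definable_bex; [term_definable|].
    apply definable_bex; [term_definable|].
    (* Below the three quantifiers [y], [x] and [z] are the variables 0, 1 and 2; the reindexing
       keeps [y] and [x] and skips [z]. *)
    apply definable_ext with (fun e => (fun e' => R (tail e') (e' O))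
      (fun n => e (scons O (scons 1%nat (fun k => S (S (S k)))) n))).
    + intros e; match goal with |- R ?a _ <-> R ?b _ => replace a with b end;
        [reflexivity|].
      apply functional_extensionality; intros [|n]; reflexivity.
    + exact (definable_rename _ HR).
  - intros e; split.
    + intros [x Hx]; apply HQ in Hx as [y Hy].
      exists (x + y), x; split; [lt_by y|].
      exists y; split; [lt_by x|exact Hy].
    + intros (z & x & _ & y & _ & Hy); exists x; apply HQ; eauto.
Qed.

(** If there were no least element, descending from [d] would give for every [j] some [x] in [P]
    with [x + j] at most [d]. This is a Sigma^0_1 induction, and [j = d + 1] refutes it. *)
Lemma sigma1_least (P : num M -> Prop) d :
  sigma1 (fun e => P (e O)) -> P d ->
  exists n, P n /\ forall m, m < n -> ~ P m.
Proof.
  intros HP Hd; apply NNPP; intros Hno.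
  assert (H : forall j, exists x, x + j < d + 1 /\ P x).
  { intros j; sigma1_induct j.
    - apply sigma1_ex, sigma1_and_definable; [definable|].
      exact (sigma1_rename (fun _ => O) HP).
    - exists d; split; [lt_by (0 : num M)|exact Hd].
    - intros n (x & Hx & HPx); apply NNPP; intros Hn; apply Hno; exists x.
      split; [exact HPx|]; intros m Hm HPm; apply Hn; exists m.
      split; [|exact HPm].
      apply (num_lt_elim HM) in Hm as [z ->].
      apply (num_le_elim HM) in Hx as [w ->]; lt_by (z + w). }
  destruct (H (d + 1)) as (x & Hx & _).
  apply (num_le_elim HM) in Hx as [z Hz].
  apply (num_neq_add_succ (x := d) (z := x + z)); rewrite Hz at 1; ring.
Qed.

(** * Divisibility and bounding principles *)

Lemma definable_divides ar s t :
  @term_definable M s -> term_definable t ->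
  definable ar (fun e => divides (s e) (t e)).
Proof.
  intros Hs Ht.
  apply definable_ext with (fun e => exists q, q < t e + 1 /\ t e = q * s e);
    [|definable].
  intros e; unfold divides; split.
  - intros (q & _ & Hq); eauto.
  - intros [q Hq]; destruct (num_case HM (s e)) as [Hz|[a Ha]].
    (* A zero divisor forces a zero dividend, so the quotient 0 respects the bound; for a nonzero
       divisor every quotient is at most the dividend. *)
    + exists 0; split; [lt_by (t e)|].
      rewrite Hq, Hz; ring.
    + exists q; split; [|exact Hq].
      rewrite Hq, Ha; lt_by (q * a).
Qed.

Lemma divides_mul_l (d a k : num M) : divides d a -> divides d (k * a).
Proof. intros [q ->]; exists (k * q); ring. Qed.

(** In the absence of subtraction the quotients are compared; if that of [a] is the larger one, then
    [e] must be 0. *)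
Lemma divides_add_cancel (c a e : num M) :
  divides c (a + e) -> divides c a -> divides c e.
Proof.
  intros [q Hq] [p ->]; destruct (num_compare HM p q) as [[z ->]|[z ->]].
  - exists z; apply (num_add_cancel_l HM (c := p * c)); rewrite Hq; ring.
  - exists 0; enough (e = 0) as -> by ring.
    apply (num_add_eq_0 (x := (z + 1) * c)).
    apply (num_add_cancel_l HM (c := q * c)).
    transitivity ((q + z + 1) * c + e); [ring|rewrite Hq; ring].
Qed.

Ltac definable_derived ::=
  match goal with
  | |- definable _ (fun e => divides _ _) =>
      apply definable_divides; term_definable
  end.

(** The affine form serves two purposes: [a = 1], [b = 0] gives a common multiple of an initial
    segment of positive numbers, and [b = 1] one of Goedel's moduli. *)
Lemma common_multiple (a b k : num M) :
  (forall n, a * (n + 1) + b <> 0) ->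
  exists p, p <> 0 /\ forall n, n < k -> divides (a * (n + 1) + b) p.
Proof.
  intros Hc; sigma1_induct k.
  - apply sigma1_ex_definable; definable.
  - exists 1; split.
    + intros H; apply (succ_neq0 B (n := 0)); transitivity (1 : num M); [ring|exact H].
    + intros n Hn; destruct (nlt_0 B Hn).
  - intros k (p & Hp & H); exists (p * (a * (k + 1) + b)); split.
    + apply num_mul_neq0; auto.
    + intros n Hn; apply (lt_succ B) in Hn as [Hn| ->].
      * destruct (H n Hn) as [q ->]; exists (q * (a * (k + 1) + b)); ring.
      * exists p; reflexivity.
Qed.

(* Goedel's moduli are pairwise coprime; the inverses are explicit. *)
Lemma divides_modulus_cancel (a x y e m : num M) :
  (forall n, n < m -> divides (1 * (n + 1) + 0) a) ->
  x < m -> y < m -> x <> y ->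
  divides (a * (y + 1) + 1) (e * (a * (x + 1) + 1)) ->
  divides (a * (y + 1) + 1) e.
Proof.
  intros Ha Hx Hy Hxy Hdiv.
  destruct (num_lt_total Hxy) as [H|H];
    apply (num_lt_elim HM) in H as [d Hd]; subst.
  - destruct (Ha d) as [r ->].
    { apply (num_lt_trans HM) with (2 := Hy); lt_by x. }
    (* Here [d + 1] is the gap between the two indices and [a = r * (d + 1)]. Modulo the modulus of
       the second index, multiplying the other modulus by [r] and by the square of the second index
       plus one gives -1 in this case and 1 in the next. *)
    eapply divides_add_cancel;
      [|apply divides_mul_l with (k := r * (x + d + 1 + 1) * (x + d + 1 + 1)),
        Hdiv].
    exists ((1 + r * (x + 1) * (x + d + 1 + 1)) * e); ring.
  - destruct (Ha d) as [r ->].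
    { apply (num_lt_trans HM) with (2 := Hx); lt_by y. }
    destruct Hdiv as [q Hq].
    eapply divides_add_cancel.
    2: exists (r * (y + 1) * (y + d + 1 + 1) * e); reflexivity.
    exists (r * (y + 1) * (y + 1) * q + e).
    transitivity (r * (y + 1) * (y + 1) *
      (e * (r * (1 * (d + 1) + 0) * (y + d + 1 + 1) + 1)) +
      e * (r * (1 * (d + 1) + 0) * (y + 1) + 1)); [ring|].
    rewrite Hq; ring.
Qed.

(* The least multiple [d] of the moduli of all [n < m] not yet enumerated by
   some stage [b] determines [b]: enumerating one more [n] later would allow
   dividing [d] by the modulus of [n]. *)
Lemma strong_bounding (T : num M -> num M -> Prop) (m : num M) :
  definable2 false T -> (forall n y z, T n y -> y < z -> T n z) ->
  exists b, forall n y, n < m -> T n y -> T n b.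
Proof.
  intros HT Hmono.
  (* Since [a] is a nonzero multiple of [1, ..., m], the moduli [a * (n + 1) + 1] with [n < m] are
     pairwise coprime. Their common multiple [p] is the starting point for the minimization. *)
  destruct (@common_multiple 1 0 m) as (a & Ha0 & Ha).
  { intros n H; apply (succ_neq0 B (n := n)); rewrite <- H; ring. }
  destruct (@common_multiple a 1 m) as (p & Hp0 & Hp).
  { intros n; apply (succ_neq0 B). }
  destruct (@sigma1_least (fun d => exists b, d <> 0 /\
    forall n, n < m -> T n b \/ divides (a * (n + 1) + 1) d) p)
    as (d & (b & Hd0 & Hb) & Hmin).
  - apply sigma1_ex_definable; definable.
  - exists 0; split; [exact Hp0|]; auto.
  - exists b; intros x y Hx Hy; apply NNPP; intros Hxb.
    destruct (Hb x Hx) as [|[e He]]; [contradiction|].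
    assert (Hby : b < y).
    { apply NNPP; intros Hby; apply Hxb.
      destruct (classic (y = b)) as [<-|Hyb]; [exact Hy|].
      destruct (num_lt_total Hyb) as [H|H]; [eauto|contradiction]. }
    assert (He0 : e <> 0).
    { intros ->; apply Hd0; rewrite He; ring. }
    apply (Hmin e).
    (* Minimality applies to [e] because [d = e + e * a * (x + 1)] with a nonzero second summand. *)
    + destruct (num_case HM (e * a * (x + 1))) as [H|[z Hz]].
      * exfalso; revert H; repeat apply num_mul_neq0; auto.
        apply (succ_neq0 B).
      * rewrite He; replace (e * (a * (x + 1) + 1)) with (e + e * a * (x + 1))
          by ring; rewrite Hz; lt_by z.
    + exists y; split; [exact He0|]; intros n Hn.
      destruct (classic (x = n)) as [<-|Hxn]; [auto|].
      destruct (Hb n Hn) as [H|H]; [eauto|right].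
      rewrite He in H; exact (divides_modulus_cancel Ha Hx Hn Hxn H).
Qed.

(** Having a witness below [b] is monotone in [b], so [strong_bounding] yields one bound for all
    [n < m]. *)
Lemma collection (Q : num M -> num M -> Prop) (m : num M) :
  definable2 false Q -> (forall n, n < m -> exists y, Q n y) ->
  exists b, forall n, n < m -> exists y, y < b /\ Q n y.
Proof.
  intros HQ H.
  destruct (@strong_bounding (fun n b => exists y, y < b /\ Q n y) m)
    as [b Hb].
  - intros s t Hs Ht; definable.
  - intros n y z (w & Hw & HQw) Hyz; exists w; split; [|exact HQw].
    exact (num_lt_trans HM Hw Hyz).
  - exists b; intros n Hn; destruct (H n Hn) as [y Hy].
    apply Hb with (y + 1); [exact Hn|].
    exists y; split; [apply num_lt_succ_diag|exact Hy].
Qed.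

(** * Codes of finite sets *)

Lemma fin_mem_lt (x a : num M) : fin_mem x a -> x < a.
Proof.
  intros (k & m & n & -> & Hx & _).
  apply num_lt_le_trans with (1 := Hx), code_pair_fst.
Qed.

Lemma definable_fin_mem ar s t :
  @term_definable M s -> term_definable t ->
  definable ar (fun e => fin_mem (s e) (t e)).
Proof.
  intros Hs Ht.
  apply definable_ext with (fun e => exists k, k < t e + 1 /\
    exists m, m < t e + 1 /\ exists n, n < t e + 1 /\
      (t e = <<k, <<m, n>>>> /\ s e < k /\
       divides (m * (s e + 1) + 1) n)); [|definable].
  intros e; split.
  - intros (k & _ & m & _ & n & _ & H); exists k, m, n; exact H.
  - intros (k & m & n & H); assert (Ha := proj1 H).
    assert (Hmn : <<m, n>> < t e + 1) by (rewrite Ha; apply code_pair_snd).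
    exists k; split; [rewrite Ha; apply code_pair_fst|].
    exists m; split.
    { apply num_le_lt_trans with (2 := Hmn), code_pair_fst. }
    exists n; split; [|exact H].
    apply num_le_lt_trans with (2 := Hmn), code_pair_snd.
Qed.

Ltac definable_derived ::=
  match goal with
  | |- definable _ (fun e => fin_mem _ _) =>
      apply definable_fin_mem; term_definable
  end.

(** The elements of both sets lie below [t e], so their comparison needs only a bounded
    quantifier. *)
Lemma definable_is_code ar t :
  @term_definable M t -> definable ar (fun e => is_code (t e)).
Proof.
  intros Ht.
  apply definable_ext with (fun e => forall b, b < t e ->
    ~ (forall x, x < t e -> (fin_mem x b <-> fin_mem x (t e))));
    [|definable].
  intros e; split; intros H b Hb Hx; apply (H b Hb).
  - intros x _; apply Hx.
  - intros x; split; intros Hf.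
    + apply Hx; [|exact Hf].
      exact (num_lt_trans HM (fin_mem_lt Hf) Hb).
    + apply Hx; [exact (fin_mem_lt Hf)|exact Hf].
Qed.

Lemma least_code (a : num M) :
  exists b, is_code b /\ forall x, fin_mem x b <-> fin_mem x a.
Proof.
  destruct (@sigma1_least (fun b =>
    forall x, x < a + b -> (fin_mem x b <-> fin_mem x a)) a)
    as (b & Hb & Hmin).
  - apply sigma1_definable; definable.
  - intros x _; reflexivity.
  - assert (Hb' : forall x, fin_mem x b <-> fin_mem x a).
    { intros x; split; intros Hx; apply Hb; auto using num_lt_add_l,
        num_lt_add_r, fin_mem_lt. }
    exists b; split; [|exact Hb'].
    intros c Hc H; apply (Hmin c Hc); intros x _; rewrite H; apply Hb'.
Qed.

(** With [k = m = i + 1], the chosen [n] is exactly the modulus of [i]. A smaller [x] is excluded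
    because its modulus, like [n], is congruent to 1 modulo [i + 1], which restricts the cofactor
    too strongly. *)
Lemma singleton_code (i : num M) :
  exists a, is_code a /\ forall x, fin_mem x a <-> x = i.
Proof.
  destruct (least_code <<i + 1, <<i + 1, (i + 1) * (i + 1) + 1>>>>)
    as (a & Ha & H); exists a; split; [exact Ha|].
  intros x; rewrite H; split.
  - intros (k & m & n & Heq & Hx & q & Hq).
    apply code_pair_inj in Heq as [<- Heq].
    apply code_pair_inj in Heq as [<- <-].
    apply (lt_succ B) in Hx as [Hx|Hx]; [exfalso|exact Hx].
    apply (num_lt_elim HM) in Hx as [z ->].
    destruct (num_case HM q) as [->|[p ->]].
    { apply (succ_neq0 B (n := (x + z + 1 + 1) * (x + z + 1 + 1))).
      rewrite Hq; ring. }
    (* [p + 1] is congruent to 1 modulo [i + 1], so it is 1 or too large. *)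
    destruct (num_compare HM ((p + 1) * (x + 1)) (x + z + 1 + 1))
      as [[w Hw]|[w Hw]].
    + assert (Hp : p = (x + z + 1 + 1) * w).
      { apply (num_add_cancel_r HM
          (c := (p + 1) * ((x + z + 1 + 1) * (x + 1)) + 1)).
        transitivity ((p + 1) * ((x + z + 1 + 1) * (x + 1) + 1)); [ring|].
        rewrite <- Hq.
        transitivity ((x + z + 1 + 1) * ((p + 1) * (x + 1) + w) + 1).
        - rewrite <- Hw; reflexivity.
        - ring. }
      destruct (num_case HM w) as [->|[v ->]].
      * assert (Hp0 : p = 0) by (rewrite Hp; ring).
        rewrite Hp0 in Hw.
        apply (num_neq_add_succ (x := x + 1) (z := z)).
        transitivity ((0 + 1) * (x + 1) + 0); [ring|].
        rewrite <- Hw; ring.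
      * apply (num_neq_add_succ (x := x + z + 1 + 1)
          (z := (x + z + 1 + 1) * v + p * x + x + v + 1)).
        transitivity ((p + 1) * (x + 1) + (v + 1)); [exact Hw|].
        transitivity (p + (p * x + x + v + 1 + 1)); [ring|].
        rewrite Hp at 1; ring.
    + apply (num_neq_add_succ
        (x := (x + z + 1 + 1) * (x + z + 1 + 1) + 1)
        (z := (x + z + 1 + 1) * w + (x + z + 1) + p)).
      rewrite Hq at 1.
      transitivity ((x + z + 1 + 1) * ((p + 1) * (x + 1)) + (p + 1)); [ring|].
      rewrite Hw; ring.
  - intros ->; exists (i + 1), (i + 1), ((i + 1) * (i + 1) + 1).
    split; [reflexivity|]; split; [apply num_lt_succ_diag|].
    exists 1; ring.
Qed.

End Numbers.

Ltac definable_derived ::=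
  match goal with
  | |- definable _ (fun e => fin_mem _ _) =>
      apply definable_fin_mem; [assumption|term_definable..]
  | |- definable _ (fun e => is_code _) =>
      apply definable_is_code; [assumption|term_definable]
  end.

(** * Arithmetical comprehension from one unbounded quantifier *)

Definition projection_comprehension (M : L2_structure) : Prop :=
  forall R : set M, exists X : set M,
    forall n, n \in X <-> exists m, <<n, m>> \in R.

Section Projection.

Context (M : L2_structure) (HM : RCA0 M).
Context (HP : projection_comprehension M).

Lemma sigma1_comprehension (P : num M -> Prop) :
  sigma1 (fun e => P (e O)) -> exists X : set M, forall n, n \in X <-> P n.
Proof.
  intros (Q & HQ & H).
  (* The graph of the bounded matrix is a set, and the required set is its projection. All variables
     of the matrix are given the value [n], as [P] reads only variable 0. *)
  destruct (@definable_comprehension M HM (fun p => exists n, n < p + 1 /\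
    exists x, x < p + 1 /\ (p = <<n, x>> /\ Q (fun _ => n) x))) as [R HR].
  - apply definable_bex; [term_definable|].
    apply definable_bex; [term_definable|].
    apply definable_and; [definable|].
    exact (definable_rename (scons O (fun _ => 1%nat)) HQ).
  - destruct (HP R) as [X HX]; exists X; intros n.
    rewrite HX; setoid_rewrite HR; rewrite (H (fun _ => n)); split.
    + intros (m & n' & _ & x & _ & Heq & Hx).
      apply (code_pair_inj HM) in Heq as [-> ->]; eauto.
    + intros [x Hx]; exists x, n; split; [apply (code_pair_fst HM)|].
      exists x; split; [apply (code_pair_snd HM)|]; auto.
Qed.

(* All variables of a formula are coded into one by iterated pairing. *)
Lemma sigma1_is_definable N : forall P : (nat -> num M) -> Prop,
  sigma1 P -> (forall e e', agree N e e' -> (P e <-> P e')) ->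
  definable false P.
Proof.
  induction N as [|[|N] IH]; intros P HS HN.
  - apply definable_ext with (fun _ => P (fun _ => 0)); [|apply definable_prop].
    intros e; apply HN; intros n Hn; destruct (PeanoNat.Nat.nlt_0_r n Hn).
  - destruct (@sigma1_comprehension (fun n => P (fun _ => n))) as [X HX].
    { exact (sigma1_rename (fun _ => O) HS). }
    apply definable_ext with (fun e => e O \in X); [|definable].
    intros e; rewrite HX; apply HN; intros [|n] Hn; [reflexivity|].
    apply PeanoNat.Nat.succ_lt_mono in Hn.
    destruct (PeanoNat.Nat.nlt_0_r n Hn).
  - assert (HD : definable false (fun e => exists a, exists b,
      e O = <<a, b>> /\ P (scons a (scons b (tail e))))).
    { apply IH.
      - do 2 apply (sigma1_ex HM); apply sigma1_and_definable; [definable|].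
        eapply sigma1_ext; [|exact (sigma1_rename
          (scons 1%nat (scons O (fun n => S (S (S n))))) HS)].
        intros e; cbv beta; match goal with |- P ?a <-> P ?b => replace a with b end;
          [reflexivity|].
        apply functional_extensionality; intros [|[|n]]; reflexivity.
      - intros e e' He.
        rewrite (He O (PeanoNat.Nat.lt_0_succ N)).
        assert (Hab : forall a b, P (scons a (scons b (tail e))) <->
          P (scons a (scons b (tail e')))).
        { intros a b; apply HN; intros [|[|n]] Hn; [reflexivity..|].
          apply He, PeanoNat.Nat.succ_lt_mono, Hn. }
        setoid_rewrite Hab; reflexivity. }
    (* [HD] expects the code as a variable, so the pair of the first two variables enters through a
       bounded quantifier over [z]. *)
    apply definable_ext with (fun e => exists z, z < <<e O, e 1%nat>> + 1 /\
      (z = <<e O, e 1%nat>> /\ exists a, exists b, z = <<a, b>> /\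
        P (scons a (scons b (tail (tail e)))))).
    + intros e.
      assert (He : P (scons (e O) (scons (e 1%nat) (tail (tail e)))) <-> P e).
      { rewrite <- (scons_tail e) at 4; rewrite <- (scons_tail (tail e)).
        reflexivity. }
      split.
      * intros (z & _ & -> & a & b & Heq & H).
        apply (code_pair_inj HM) in Heq as [<- <-]; apply He, H.
      * intros H; exists <<e O, e 1%nat>>.
        split; [apply (num_lt_succ_diag HM)|]; split; [reflexivity|].
        exists (e O), (e 1%nat); split; [reflexivity|apply He, H].
    + apply definable_bex; [term_definable|].
      apply definable_and; [definable|].
      exact (definable_rename (scons O (fun n => S (S (S n)))) HD).
Qed.

Lemma term_definable_eval t : term_definable (fun e : nat -> num M => eval e t).
Proof.
  induction t; simpl; term_definable.
Qed.

(** Unbounded quantifiers are eliminated from the inside out: over a bounded matrix each gives a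
    Sigma^0_1 relation or the negation of one, which projections make bounded again in new set
    parameters. *)
Lemma arithmetical_definable A : arithmetical A ->
  forall E : nat -> set M, definable false (fun e => sat e E A).
Proof.
  assert (Ht := term_definable_eval).
  induction A; simpl; intros HA E; try (destruct HA; fail).
  - apply definable_eq; apply Ht.
  - apply definable_lt; apply Ht.
  - apply definable_mem, Ht.
  - apply definable_not; auto.
  - destruct HA; apply definable_and; auto.
  - destruct HA; apply definable_or; auto.
  - destruct HA; apply definable_imp; auto.
  - apply definable_ball; [apply Ht|].
    apply definable_ext with (2 := IHA HA E).
    intros e; rewrite scons_tail; reflexivity.
  - apply definable_bex; [apply Ht|].
    apply definable_ext with (2 := IHA HA E).
    intros e; rewrite scons_tail; reflexivity.
  - apply definable_ext with (fun e => ~ exists x, ~ sat (scons x e) E A).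
    { intros e; split; [|intros H [x Hx]; auto].
      intros H x; apply NNPP; intros Hx; eauto. }
    apply definable_not.
    assert (HS : sigma1 (fun e => exists x, ~ sat (scons x e) E A)).
    { apply sigma1_ex_definable, definable_not.
      apply definable_ext with (2 := IHA HA E).
      intros e; rewrite scons_tail; reflexivity. }
    destruct (sigma1_agree HS) as [N HN].
    exact (sigma1_is_definable HS HN).
  - assert (HS : sigma1 (fun e => exists x, sat (scons x e) E A)).
    { apply sigma1_ex_definable.
      apply definable_ext with (2 := IHA HA E).
      intros e; rewrite scons_tail; reflexivity. }
    destruct (sigma1_agree HS) as [N HN].
    exact (sigma1_is_definable HS HN).
Qed.

Lemma definable_instantiate ar (P : (nat -> num M) -> Prop) e0 :
  definable ar P -> definable ar (fun e => P (scons (e O) e0)).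
Proof.
  intros (A & c & E & HA & H).
  set (r := interleave (scons O (fun k => odd_index (even_index k)))
    (fun k => odd_index (odd_index k))).
  exists (rename r (fun n => n) A), (interleave e0 c), E.
  split; [apply formula_class_rename, HA|].
  intros e; rewrite sat_rename, <- H; simpl.
  replace (fun n => interleave e (interleave e0 c) (r n))
    with (interleave (scons (e O) e0) c); [reflexivity|].
  apply functional_extensionality; intros n; unfold r.
  rewrite (map_interleave (interleave e (interleave e0 c))).
  f_equal; apply functional_extensionality.
  - intros [|k]; symmetry; [reflexivity|].
    transitivity (interleave e0 c (even_index k));
      [|exact (interleave_even e0 c k)].
    exact (interleave_odd e (interleave e0 c) (even_index k)).
  - intros k; symmetry; rewrite interleave_odd; apply interleave_odd.
Qed.

Lemma projection_comprehension_ACA0 : ACA0 M.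
Proof.
  constructor.
  - exact (RCA0_basic HM).
  - intros X H0 HS; apply (definable_induction HM); [definable|exact H0|exact HS].
  - intros A HA e E; apply (definable_comprehension HM).
    exact (definable_instantiate e (arithmetical_definable HA E)).
Qed.

End Projection.

(** * Witnesses under arithmetical comprehension *)

Section Arithmetical.

Context (M : L2_structure) (HM : RCA0 M) (HA : ACA0 M).

Lemma ACA0_definable_comprehension (P : num M -> Prop) :
  definable true (fun e => P (e O)) ->
  exists X : set M, forall n, n \in X <-> P n.
Proof.
  intros (A & c & E & HAr & H).
  destruct (ACA0_comprehension HA
    (formula_class_rename (ar := true) push_param (fun n => n) HAr)
    (interleave (fun _ => 0) c) E) as [X HX].
  exists X; intros n; rewrite HX, sat_push, H; reflexivity.
Qed.

(** The function takes the least witness, which is arithmetical in [G]. *)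
Lemma ACA0_choice (D R : num M -> Prop) (G : num M -> num M -> Prop) :
  definable1 true D -> definable2 true G ->
  (forall x i, G x i -> R i) -> (forall x, D x -> exists i, G x i) ->
  exists f, is_function D R f /\ forall x i, <<x, i>> \in f -> G x i.
Proof.
  intros HD HG HR Hex.
  destruct (@ACA0_definable_comprehension (fun p => exists x, exists i,
    p = <<x, i>> /\ D x /\ G x i /\ forall j, j < i -> ~ G x j)) as [f Hf].
  { definable. }
  assert (Hf' : forall x i, <<x, i>> \in f <->
    D x /\ G x i /\ forall j, j < i -> ~ G x j).
  { intros x i; rewrite Hf; split; [|intros H; exists x, i; tauto].
    intros (x' & i' & Heq & H); apply (code_pair_inj HM) in Heq as [<- <-].
    exact H. }
  exists f; split; [split|].
  - intros p Hp; apply Hf in Hp as (x & i & -> & HDx & HGx & _).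
    exists x, i; eauto.
  - intros x Hx.
    (* Once the witnesses of [x] form a set, the least number principle for Sigma^0_1 properties
       applies to them. *)
    destruct (@ACA0_definable_comprehension (fun i => G x i)) as [Y HY].
    { definable. }
    destruct (Hex x Hx) as [i0 Hi0].
    destruct (@sigma1_least M HM (fun i => i \in Y) i0) as (i & Hi & Hmin).
    { apply sigma1_definable; definable. }
    { apply HY, Hi0. }
    assert (Hmin' : forall j, j < i -> ~ G x j).
    { intros j Hj HGj; apply (Hmin j Hj), HY, HGj. }
    apply HY in Hi; exists i; split; [apply Hf'; auto|].
    intros j Hj; apply Hf' in Hj as (_ & HGj & Hminj).
    apply NNPP; intros Hij; destruct (num_lt_total HM Hij) as [H|H].
    + exact (Hminj i H Hi).
    + exact (Hmin' j H HGj).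
  - intros x i H; apply Hf' in H; tauto.
Qed.

Lemma ACA0_compact_effectively_compact : compact_effectively_compact M.
Proof.
  intros S HS; split; [exact HS|].
  destruct (@ACA0_definable_comprehension (fun a =>
    finite_subset_index S a /\ covers S (fun i => fin_mem i a))) as [C HC].
  { unfold finite_subset_index, covers; definable. }
  exists C; split; intros a; rewrite HC; tauto.
Qed.

Lemma ACA0_discrete_effectively_discrete : discrete_effectively_discrete M.
Proof.
  intros S HS.
  destruct (@ACA0_choice (fun x => x \in points S) (fun i => i \in index S)
    (fun x i => i \in index S /\ forall y, section (base S) i y <-> y = x))
    as (d & Hd & Hspec).
  - intros t Ht; definable.
  - intros s t Hs Ht; definable.
  - tauto.
  - exact HS.
  - exists d; split; [exact Hd|]; intros x i _ Hi; apply (Hspec x i Hi).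
Qed.

(** Both neighbourhoods are chosen together as one coded pair, and the choice function is then
    composed with the two coordinates. *)
Lemma ACA0_hausdorff_effectively_hausdorff : hausdorff_effectively_hausdorff M.
Proof.
  intros S HS.
  set (XX := fun p : num M => exists x0 x1,
    x0 \in points S /\ x1 \in points S /\ p = <<x0, x1>>).
  destruct (@ACA0_choice XX
    (fun q => exists i, exists j, i \in index S /\ j \in index S /\ q = <<i, j>>)
    (fun p q => exists x0, exists x1, exists i, exists j,
      p = <<x0, x1>> /\ q = <<i, j>> /\ i \in index S /\ j \in index S /\
      (x0 <> x1 -> section (base S) i x0 /\ section (base S) j x1 /\
       forall y, ~ (section (base S) i y /\ section (base S) j y))))
    as (h & Hh & Hspec).
  - intros t Ht; unfold XX; definable.
  - intros s t Hs Ht; definable.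
  - intros p q (x0 & x1 & i & j & _ & -> & Hi & Hj & _); eauto 6.
  - intros p (x0 & x1 & Hx0 & Hx1 & ->).
    destruct (classic (x0 = x1)) as [<-|Hne].
    (* The functions must also be defined on the diagonal; any basic neighbourhood of the point
       serves as default. *)
    + destruct (base_cover Hx0) as (i & Hi & _).
      exists <<i, i>>, x0, x0, i, i; tauto.
    + destruct (HS x0 x1 Hx0 Hx1 Hne) as (i & j & Hi & Hj & H).
      exists <<i, j>>, x0, x1, i, j; tauto.
  - assert (Hproj : forall pr : num M -> num M -> num M,
      (forall i j i' j', <<i, j>> = <<i', j'>> -> pr i j = pr i' j') ->
      term_definable (fun e => pr (e O) (e 1%nat)) ->
      (forall i j, i \in index S -> j \in index S -> pr i j \in index S) ->
      exists g, is_function XX (fun i => i \in index S) g /\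
      forall p k, <<p, k>> \in g ->
        exists i j, <<p, <<i, j>>>> \in h /\ k = pr i j).
    { intros pr Hinj Hpr HI.
      destruct (@ACA0_definable_comprehension (fun q => exists p, exists j,
        exists i, q = <<p, pr i j>> /\ <<p, <<i, j>>>> \in h)) as [g Hg].
      { do 3 apply definable_ex; apply definable_and; [|definable].
        apply definable_eq; [term_definable|].
        apply term_definable_pair; [term_definable|exact Hpr]. }
      exists g; split; [split|].
      - intros q Hq; apply Hg in Hq as (p & j & i & -> & Hp).
        destruct (proj1 Hh _ Hp) as (p' & q & HX & (i' & j' & Hi & Hj & ->) & Heq).
        apply (code_pair_inj HM) in Heq as [<- Heq].
        apply (code_pair_inj HM) in Heq as [<- <-].
        exists p, (pr i j); auto.
      - intros p HX; destruct (proj2 Hh p HX) as (q & Hq & Huniq).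
        destruct (proj1 Hh _ Hq) as (p' & q' & _ & (i & j & Hi & Hj & ->) & Heq).
        apply (code_pair_inj HM) in Heq as [<- ->].
        exists (pr i j); split; [apply Hg; eauto|].
        intros k Hk; apply Hg in Hk as (p' & j' & i' & Heq & Hp').
        apply (code_pair_inj HM) in Heq as [<- ->].
        apply Hinj, Huniq, Hp'.
      - intros p k Hk; apply Hg in Hk as (p' & j & i & Heq & Hp').
        apply (code_pair_inj HM) in Heq as [<- ->]; eauto. }
    assert (Hinj : forall i j i' j', <<i, j>> = <<i', j'>> -> i = i' /\ j = j')
      by exact (code_pair_inj HM).
    destruct (Hproj (fun i _ => i)) as (h0 & Hh0 & Hspec0).
    { intros; eapply proj1, Hinj; eassumption. }
    { term_definable. }
    { auto. }
    destruct (Hproj (fun _ j => j)) as (h1 & Hh1 & Hspec1).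
    { intros; eapply proj2, Hinj; eassumption. }
    { term_definable. }
    { auto. }
    exists h0, h1; split; [exact Hh0|]; split; [exact Hh1|].
    intros x0 x1 i j Hx0 Hx1 Hne Hi Hj.
    apply Hspec0 in Hi as (i' & j0 & Hi & ->).
    apply Hspec1 in Hj as (i0 & j' & Hj & ->).
    assert (HX : XX <<x0, x1>>) by (exists x0, x1; auto).
    (* Uniqueness of the value of [h] shows that both coordinates come from the same pair. *)
    destruct (proj2 Hh _ HX) as (q & _ & Huniq).
    apply Huniq in Hj as Hqj; apply Huniq in Hi as Hqi.
    rewrite Hqj in Hqi; apply Hinj in Hqi as [-> ->].
    apply Hspec in Hi as (y0 & y1 & i & j & Heq & Heq' & _ & _ & H).
    apply Hinj in Heq as [<- <-], Heq' as [<- <-]; auto.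
Qed.

End Arithmetical.

(** * Spaces in which every point has a sequence of neighbourhoods *)

(** This interface hides the coding of the base and of the refinement function from the arguments
    about particular spaces. *)
Definition presents (M : L2_structure) (S : csc_space M)
    (V : num M -> num M -> num M -> Prop) : Prop :=
  (forall x, x \in points S) /\
  (forall i, i \in index S <-> exists x s, i = <<x, s>>) /\
  (forall i y, section (base S) i y <-> exists x s, i = <<x, s>> /\ V x s y).

Lemma discrete_hausdorff (M : L2_structure) (S : csc_space M) :
  discrete S -> hausdorff S.
Proof.
  intros HS x0 x1 Hx0 Hx1 Hne.
  destruct (HS x0 Hx0) as (i & Hi & HUi), (HS x1 Hx1) as (j & Hj & HUj).
  exists i, j; repeat split; auto.
  - apply HUi; reflexivity.
  - apply HUj; reflexivity.
  - intros y [Hyi Hyj]; apply HUi in Hyi; apply HUj in Hyj; congruence.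
Qed.

Section Spaces.

Context (M : L2_structure) (HM : RCA0 M).

Add Ring num_ring : (num_semiring HM).

Ltac pair_inj :=
  repeat match goal with
  | H : <<_, _>> = <<_, _>> |- _ => apply (code_pair_inj HM) in H as [? ?]
  end; subst.

Lemma le_pair_fst (x a b : num M) : x < a + 1 -> x < <<a, b>> + 1.
Proof.
  intros H; apply (num_le_lt_trans HM) with (1 := H), (code_pair_fst HM).
Qed.

Lemma le_pair_snd (x a b : num M) : x < b + 1 -> x < <<a, b>> + 1.
Proof.
  intros H; apply (num_le_lt_trans HM) with (1 := H), (code_pair_snd HM).
Qed.

Ltac le_pair :=
  first
    [ apply (num_lt_succ_diag HM)
    | apply le_pair_fst; le_pair
    | apply le_pair_snd; le_pair ].

(** Around [y], the neighbourhoods with parameters [x, s] and [x', s'] are refined by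
    [V y (x + s + (x' + s') + 1)], whose stage exceeds both [x + s] and [x' + s']. All components of
    a pair are bounded by its code, so the required sets exist by bounded comprehension. *)
Lemma shrinking_space (V : num M -> num M -> num M -> Prop) :
  definable3 false V -> (forall x s, V x s x) ->
  (forall x s y t z, V x s y -> x + s < t -> V y t z -> V x s z) ->
  exists S : csc_space M, presents S V.
Proof.
  intros HV Hrefl Hshrink.
  destruct (@definable_comprehension M HM (fun n => n = n)) as [X HX];
    [definable|].
  destruct (@definable_comprehension M HM (fun i => exists x, x < i + 1 /\
    exists s, s < i + 1 /\ i = <<x, s>>)) as [I HI]; [definable|].
  destruct (@definable_comprehension M HM (fun p => exists y, y < p + 1 /\
    exists x, x < p + 1 /\ exists s, s < p + 1 /\
    (p = <<y, <<x, s>>>> /\ V x s y))) as [U HU]; [definable|].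
  destruct (@definable_comprehension M HM (fun p => exists y, y < p + 1 /\
    exists x, x < p + 1 /\ exists s, s < p + 1 /\
    exists x', x' < p + 1 /\ exists s', s' < p + 1 /\
    p = <<<<y, <<<<x, s>>, <<x', s'>>>>>>, <<y, x + s + (x' + s') + 1>>>>))
    as [K HK]; [definable|].
  assert (HX' : forall x, x \in X) by (intros x; apply HX; reflexivity).
  assert (HI' : forall i, i \in I <-> exists x s, i = <<x, s>>).
  { intros i; rewrite HI; split.
    - intros (x & _ & s & _ & H); eauto.
    - intros (x & s & ->); exists x; split; [le_pair|].
      exists s; split; [le_pair|reflexivity]. }
  assert (HU' : forall i y, section U i y <->
    exists x s, i = <<x, s>> /\ V x s y).
  { intros i y; unfold section; rewrite HU; split.
    - intros (y' & _ & x & _ & s & _ & H & HVy); pair_inj; eauto.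
    - intros (x & s & -> & HVy); exists y; split; [le_pair|].
      exists x; split; [le_pair|]; exists s; split; [le_pair|]; auto. }
  assert (HK' : forall p, p \in K <-> exists y x s x' s',
    p = <<<<y, <<<<x, s>>, <<x', s'>>>>>>, <<y, x + s + (x' + s') + 1>>>>).
  { intros p; rewrite HK; split.
    - intros (y & _ & x & _ & s & _ & x' & _ & s' & _ & H); eauto 6.
    - intros (y & x & s & x' & s' & ->).
      exists y; split; [le_pair|]; exists x; split; [le_pair|].
      exists s; split; [le_pair|]; exists x'; split; [le_pair|].
      exists s'; split; [le_pair|reflexivity]. }
  unshelve eexists (@CscSpace M X I U K _ _ _ _).
  - intros i x _ _; apply HX'.
  - intros x _; exists <<x, 0>>; split; [apply HI'; eauto|].
    apply HU'; exists x, 0; auto.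
  - split.
    + intros p Hp; apply HK' in Hp as (y & x & s & x' & s' & ->).
      exists <<y, <<<<x, s>>, <<x', s'>>>>>>, <<y, x + s + (x' + s') + 1>>.
      split; [|split; [apply HI'; eauto|reflexivity]].
      exists y, <<x, s>>, <<x', s'>>.
      repeat split; auto; apply HI'; eauto.
    + intros p (y & i & j & _ & Hi & Hj & ->).
      apply HI' in Hi as (x & s & ->); apply HI' in Hj as (x' & s' & ->).
      exists <<y, x + s + (x' + s') + 1>>; split.
      * apply HK'; exists y, x, s, x', s'; reflexivity.
      * intros k Hk; apply HK' in Hk as (y1 & x1 & s1 & x1' & s1' & H).
        pair_inj; reflexivity.
  - intros y i j k _ _ _ Hi Hj Hk.
    apply HK' in Hk as (y1 & x & s & x' & s' & H); pair_inj.
    apply HU' in Hi as (x1 & s1 & H & HVi); pair_inj.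
    apply HU' in Hj as (x2 & s2 & H & HVj); pair_inj.
    split; [apply HU'; eauto|].
    intros z Hz; apply HU' in Hz as (y2 & t & H & HVz); pair_inj.
    split; apply HU'; do 2 eexists; (split; [reflexivity|]).
    + apply Hshrink with (1 := HVi) (3 := HVz); lt_by (x2 + s2).
    + apply Hshrink with (1 := HVj) (3 := HVz); lt_by (x1 + s1).
  - split; [exact HX'|]; split; [exact HI'|exact HU'].
Qed.

Lemma presents_section (S : csc_space M) V x s y :
  presents S V -> (section (base S) <<x, s>> y <-> V x s y).
Proof.
  intros (_ & _ & HU); rewrite HU; split; [|eauto].
  intros (x' & s' & H & HV); pair_inj; exact HV.
Qed.

Lemma covers_iff (S : csc_space M) V P :
  presents S V -> (covers S P <-> forall y, exists i, P i /\ section (base S) i y).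
Proof.
  intros (HX & _); unfold covers; split.
  - intros H y; apply H, HX.
  - intros H y; split; auto.
Qed.

(** One listed member covers all points from [b] on. Collection bounds the stages needed for the
    points below [b], so a single late stage covers everything. *)
Lemma finite_subcover_of_cofinite (S : csc_space M) V (A : set M) x s b :
  presents S V -> is_enumerable A -> covers S (fun i => enum_mem i A) ->
  enum_mem <<x, s>> A -> (forall y, b < y + 1 -> V x s y) ->
  exists a, is_code a /\ (forall i, fin_mem i a -> enum_mem i A) /\
    covers S (fun i => fin_mem i a).
Proof.
  intros HS [Hfun Hmono] Hcov (n0 & a0 & Ha0 & Hx) Hb.
  rewrite (covers_iff _ HS) in Hcov.
  destruct (@collection M HM (fun y v => exists n, n < v /\ exists a, a < v /\
    exists i, i < v /\
    (<<n, a>> \in A /\ fin_mem i a /\ section (base S) i y)) b) as [N HN].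
  - intros t u Ht Hu; definable.
  - intros y _; destruct (Hcov y) as (i & (n & a & Ha & Hi) & Hy).
    (* The sum bounds the stage, its value and the index simultaneously. *)
    exists (n + a + i + 1), n; split; [lt_by (a + i)|].
    exists a; split; [lt_by (n + i)|].
    exists i; split; [lt_by (n + a)|]; auto.
  - destruct Hfun as [Hfun Htot].
    (* Monotonicity is stated for strictly later stages; this one lies strictly beyond all stages
       involved. *)
    destruct (Htot (N + n0 + 1) I) as (a & Ha & _).
    exists a; split; [|split].
    + destruct (Hfun _ Ha) as (n & a' & _ & Hcode & H); pair_inj; exact Hcode.
    + intros i Hi; exists (N + n0 + 1), a; auto.
    + apply (covers_iff _ HS); intros y.
      destruct (num_lt_or_ge HM y b) as [Hy|Hy].
      * destruct (HN y Hy) as (v & Hv & n & Hn & a' & _ & i & _ & Ha' & Hi & Hiy).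
        exists i; split; [|exact Hiy].
        apply Hmono with (3 := Ha) (2 := Ha') (4 := Hi).
        apply (num_lt_trans HM Hn), (num_lt_trans HM Hv); lt_by n0.
      * exists <<x, s>>; split; [|apply (presents_section _ _ _ HS), Hb, Hy].
        apply Hmono with (3 := Ha) (2 := Ha0) (4 := Hx); lt_by N.
Qed.

(** ** Effective compactness *)

Definition first_witness (R : set M) (n y : num M) : Prop :=
  <<n, y>> \in R /\ forall w, w < y -> ~ <<n, w>> \in R.

Lemma first_witness_unique R n y z :
  first_witness R n y -> first_witness R n z -> y = z.
Proof.
  intros [Hy Hy'] [Hz Hz']; apply NNPP; intros Hne.
  destruct (num_lt_total HM Hne) as [H|H].
  - exact (Hz' y H Hy).
  - exact (Hy' z H Hz).
Qed.

Lemma first_witness_exists (R : set M) n m :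
  <<n, m>> \in R -> exists y, first_witness R n y.
Proof.
  intros Hm; destruct (@sigma1_least M HM (fun y => <<n, y>> \in R) m)
    as (y & Hy & Hmin); [apply sigma1_definable; definable|exact Hm|].
  exists y; split; auto.
Qed.

Definition avoid_witnesses (R : set M) (x s y : num M) : Prop :=
  y = x \/ (~ first_witness R x y /\
            forall n, n < s -> ~ first_witness R n y).

Lemma avoid_witnesses_space R :
  exists S : csc_space M, presents S (avoid_witnesses R).
Proof.
  apply shrinking_space.
  - intros s t u Hs Ht Hu; unfold avoid_witnesses, first_witness; definable.
  - left; reflexivity.
  - intros x s y t z Hy Hst [->|[_ Hz]]; [exact Hy|right].
    (* The range up to [x + s] includes both [x] itself and every [n < s]. *)
    assert (Hst' : forall n, n < x + s + 1 -> ~ first_witness R n z).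
    { intros n Hn; apply Hz, (num_le_lt_trans HM Hn Hst). }
    split; [apply Hst'; lt_by s|].
    intros n Hn; apply Hst'; apply (num_lt_elim HM) in Hn as [w ->].
    lt_by (x + w + 1).
Qed.

(** Some [n] may have no witness at all, so collection does not suffice: strong bounding bounds the
    first witnesses of those that have one. *)
Lemma avoid_witnesses_cofinite R x s :
  exists b, forall y, b < y + 1 -> avoid_witnesses R x s y.
Proof.
  destruct (@strong_bounding M HM
    (fun n b => exists y, y < b /\ first_witness R n y) (x + s + 1)) as [b Hb].
  - intros t u Ht Hu; unfold first_witness; definable.
  - intros n y z (w & Hw & H) Hyz; exists w; split; [|exact H].
    exact (num_lt_trans HM Hw Hyz).
  - exists b; intros y Hy; right.
    assert (H : forall n, n < x + s + 1 -> ~ first_witness R n y).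
    { intros n Hn Hny; destruct (Hb n (y + 1) Hn) as (z & Hz & Hnz).
      - exists y; split; [apply (num_lt_succ_diag HM)|exact Hny].
      - rewrite (first_witness_unique Hnz Hny) in Hz.
        exact (num_not_lt_ge HM Hz Hy). }
    split; [apply H; lt_by s|].
    intros n Hn; apply H; apply (num_lt_elim HM) in Hn as [w ->].
    lt_by (x + w + 1).
Qed.

Lemma avoid_witnesses_compact R (S : csc_space M) :
  presents S (avoid_witnesses R) -> compact S.
Proof.
  intros HS A HA HI Hcov.
  destruct (proj1 (covers_iff _ HS) Hcov 0) as (i & Hi & _).
  destruct (proj1 (proj1 (proj2 HS) i) (HI i Hi)) as (x & s & ->).
  destruct (avoid_witnesses_cofinite R x s) as [b Hb].
  exact (finite_subcover_of_cofinite HS HA Hcov Hi Hb).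
Qed.

Lemma effective_compactness_projection :
  compact_effectively_compact M -> projection_comprehension M.
Proof.
  intros H R; destruct (avoid_witnesses_space R) as [S HS].
  destruct (H S (avoid_witnesses_compact HS)) as (_ & C & HCI & HC).
  apply (delta1_comprehension HM).
  - apply sigma1_ex_definable; definable.
  (* The complement becomes Sigma^0_1 through the finite covers contained in the singleton of
     [<<n, 0>>]. The middle clause excludes the case where this neighbourhood covers only because
     [n] is its own first witness. *)
  - apply sigma1_ext with (fun e => exists a, a \in C /\
      ~ first_witness R (e O) (e O) /\
      forall i, i < a -> fin_mem i a -> i = <<e O, 0>>);
      [|apply sigma1_ex_definable; unfold first_witness; definable].
    intros e; generalize (e O); clear e; intros n; split.
    + intros (a & Ha & Hnn & Hi) (m & Hm).
      destruct (first_witness_exists Hm) as [y Hy].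
      apply HC in Ha as Hcov; [|exact (HCI a Ha)].
      destruct (proj1 (covers_iff _ HS) Hcov y) as (i & Hia & Hiy).
      rewrite (Hi i (fin_mem_lt HM Hia) Hia) in Hiy.
      apply (presents_section _ _ _ HS) in Hiy as [->|[Hny _]]; contradiction.
    + intros Hn; destruct (singleton_code HM <<n, 0>>) as (a & Hcode & Ha).
      exists a; split; [|split].
      * apply HC.
        { split; [exact Hcode|]; intros i Hi; apply Ha in Hi as ->.
          apply (proj1 (proj2 HS)); eauto. }
        apply (covers_iff _ HS); intros y; exists <<n, 0>>.
        split; [apply Ha; reflexivity|].
        apply (presents_section _ _ _ HS); right; split.
        { intros [Hy _]; eauto. }
        intros k Hk; destruct (nlt_0 (RCA0_basic HM) Hk).
      * intros [Hy _]; eauto.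
      * intros i _ Hi; apply Ha, Hi.
Qed.

(** ** Discrete spaces *)

Definition reached (R : set M) (x y : num M) : Prop :=
  exists w, w < y /\ <<x, w>> \in R.

(* {x} if the bounded search up to [s] decides correctly whether [R] has a
   witness for [x]; cofinite otherwise. *)
Definition late_tail (R : set M) (x s y : num M) : Prop :=
  y = x \/ (x < y /\ reached R x y /\ ~ reached R x s).

Lemma reached_mono R x y z : reached R x y -> y < z + 1 -> reached R x z.
Proof.
  intros (w & Hw & H) Hyz; exists w; split; [|exact H].
  exact (num_lt_le_trans HM Hw Hyz).
Qed.

Lemma reached_exists (R : set M) x :
  (exists m, <<x, m>> \in R) <-> exists y, reached R x y.
Proof.
  split.
  - intros [m Hm]; exists (m + 1), m; split; [apply (num_lt_succ_diag HM)|auto].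
  - intros (y & w & _ & H); eauto.
Qed.

(** Around [x] itself a later stage can only shrink the neighbourhood. Around another point [y] of
    the tail every neighbourhood lies in [{y}] together with numbers beyond [y], and the tail is
    closed upwards. *)
Lemma late_tail_space R : exists S : csc_space M, presents S (late_tail R).
Proof.
  apply shrinking_space.
  - intros s t u Hs Ht Hu; unfold late_tail, reached; definable.
  - left; reflexivity.
  - intros x s y t z [->|(Hxy & Hy & Hs)] Hst [->|(Hyz & Hz & Ht)].
    + left; reflexivity.
    + right; split; [exact Hyz|]; split; [exact Hz|].
      intros H; apply Ht, (reached_mono H).
      apply (num_lt_elim HM) in Hst as [w ->]; lt_by (x + w + 1).
    + right; auto.
    + right; split; [exact (num_lt_trans HM Hxy Hyz)|]; split; [|exact Hs].
      apply (reached_mono Hy), (num_lt_trans HM Hyz), (num_lt_succ_diag HM).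
Qed.

Lemma late_tail_cofinite R x s :
  (exists m, <<x, m>> \in R) -> ~ reached R x s ->
  exists b, forall y, b < y + 1 -> x < y /\ late_tail R x s y.
Proof.
  intros Hx Hs; apply reached_exists in Hx as [z Hz]; exists (x + z + 1).
  intros y Hy; apply (num_le_elim HM) in Hy as [w ->].
  assert (Hlt : x < x + z + 1 + w) by lt_by (z + w).
  split; [exact Hlt|right]; split; [exact Hlt|]; split; [|exact Hs].
  apply (reached_mono Hz); lt_by (x + 1 + w).
Qed.

Lemma late_tail_discrete R (S : csc_space M) :
  presents S (late_tail R) -> discrete S.
Proof.
  intros HS x _.
  (* The stage depends on whether a witness exists, a case distinction that is not effective. *)
  assert (Hs : exists s, (exists m, <<x, m>> \in R) -> reached R x s).
  { destruct (classic (exists m, <<x, m>> \in R)) as [Hx|Hx].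
    - apply reached_exists in Hx as [s Hs]; eauto.
    - exists 0; tauto. }
  destruct Hs as [s Hs]; exists <<x, s>>; split.
  - apply (proj1 (proj2 HS)); eauto.
  - intros y; rewrite (presents_section _ _ _ HS); split; [|left; assumption].
    intros [Hy|(_ & Hy & Hn)]; [exact Hy|].
    destruct Hn; apply Hs, reached_exists; eauto.
Qed.

(** If a cover has no finite subcover, none of its listed members is cofinite. A listed [<<x, s>>]
    with [s] unreached then certifies that [x] has no witness, which makes the complement of the
    projection Sigma^0_1. *)
Lemma late_tail_compact R (S : csc_space M) :
  presents S (late_tail R) ->
  ~ (exists X : set M, forall x, x \in X <-> exists m, <<x, m>> \in R) ->
  compact S.
Proof.
  intros HS HR A HA HI Hcov; apply NNPP; intros Hno; apply HR.
  assert (Hdec : forall x s, enum_mem <<x, s>> A -> ~ reached R x s ->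
    ~ exists m, <<x, m>> \in R).
  { intros x s Hxs Hs Hx; apply Hno.
    destruct (late_tail_cofinite Hx Hs) as [b Hb].
    exact (finite_subcover_of_cofinite HS HA Hcov Hxs
      (fun y Hy => proj2 (Hb y Hy))). }
  apply (delta1_comprehension HM).
  - apply sigma1_ex_definable; definable.
  - apply sigma1_ext with (fun e => exists s, exists n, exists a,
      <<n, a>> \in A /\ fin_mem <<e O, s>> a /\ ~ reached R (e O) s).
    2: { do 2 apply (sigma1_ex HM); apply sigma1_ex_definable.
         unfold reached; definable. }
    intros e; generalize (e O); clear e; intros x; split.
    + intros (s & n & a & Hna & Ha & Hs); apply (Hdec x s); [|exact Hs].
      exists n, a; auto.
    + intros Hx; destruct (proj1 (covers_iff _ HS) Hcov x) as (i & Hi & Hix).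
      destruct (proj1 (proj1 (proj2 HS) i) (HI i Hi)) as (z & s & ->).
      apply (presents_section _ _ _ HS) in Hix as [<-|(_ & Hz & Hs)].
      * destruct Hi as (n & a & Hna & Ha); exists s, n, a.
        repeat split; auto; intros Hs; apply Hx, reached_exists; eauto.
      (* A tail around another centre [z] cannot contain [x]: it would make that listed member
         cofinite. *)
      * destruct (Hdec z s Hi Hs); apply reached_exists; eauto.
Qed.

(* Codes of finite sets exceed their elements, so the point [a] can only be
   covered by a tail. *)
Lemma late_tail_finite_cover_relation R (S : csc_space M) :
  presents S (late_tail R) -> has_finite_cover_relation S.
Proof.
  intros HS.
  assert (HI : forall a, finite_subset_index S a <->
    is_code a /\ forall i, i < a -> fin_mem i a -> i \in index S).
  { intros a; unfold finite_subset_index; split; intros [Ha H]; split; auto.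
    intros i Hi; apply H; [exact (fin_mem_lt HM Hi)|exact Hi]. }
  destruct (@definable_comprehension M HM (fun a =>
    (is_code a /\ forall i, i < a -> fin_mem i a -> i \in index S) /\
    forall y, y < a + 1 -> exists i, i < a /\
      (fin_mem i a /\ section (base S) i y))) as [C HC]; [definable|].
  exists C; split; intros a; rewrite HC, <- HI; [tauto|].
  intros Ha; rewrite (covers_iff _ HS); split.
  - intros [_ H] y; destruct (num_lt_or_ge HM y (a + 1)) as [Hy|Hy].
    + destruct (H y Hy) as (i & _ & Hi); eauto.
    + destruct (H a (num_lt_succ_diag HM a)) as (i & Hia & Hi & Hai).
      exists i; split; [exact Hi|].
      destruct (proj1 (proj1 (proj2 HS) i) (proj2 Ha i Hi)) as (x & s & ->).
      apply (presents_section _ _ _ HS) in Hai.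
      apply (presents_section _ _ _ HS).
      assert (Hxa : x < a)
        by exact (num_le_lt_trans HM (code_pair_fst HM x s) Hia).
      destruct Hai as [->|(_ & Hx & Hs)];
        [destruct (num_lt_irrefl HM Hxa)|right].
      apply (num_le_elim HM) in Hy as [z ->].
      split; [|split; [|exact Hs]].
      * apply (num_lt_trans HM Hxa); lt_by z.
      * apply (reached_mono Hx); lt_by (1 + z).
  - intros H; split; [exact Ha|]; intros y _; destruct (H y) as (i & Hi & Hy).
    exists i; split; [exact (fin_mem_lt HM Hi)|auto].
Qed.

Lemma effective_discreteness_projection :
  discrete_effcompact_effectively_discrete M -> projection_comprehension M.
Proof.
  intros H R; apply NNPP; intros HR.
  destruct (late_tail_space R) as [S HS].
  destruct (H S (late_tail_discrete HS)) as (d & [Hd1 Hd2] & Hd).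
  { split; [exact (late_tail_compact HS HR)|].
    exact (late_tail_finite_cover_relation HS). }
  apply HR, (delta1_comprehension HM).
  - apply sigma1_ex_definable; definable.
  - apply sigma1_ext with (fun e => exists s,
      <<e O, <<e O, s>>>> \in d /\ ~ reached R (e O) s);
      [|apply sigma1_ex_definable; unfold reached; definable].
    intros e; generalize (e O); clear e; intros x.
    assert (HX : x \in points S) by apply HS; split.
    + intros (s & Hs & Hns) Hx.
      destruct (late_tail_cofinite Hx Hns) as [b Hb].
      destruct (Hb b (num_lt_succ_diag HM b)) as [Hxb Hin].
      apply (presents_section _ _ _ HS), (Hd x _ HX Hs) in Hin.
      rewrite Hin in Hxb; exact (num_lt_irrefl HM Hxb).
    + intros Hx; destruct (Hd2 x HX) as (i & Hi & _).
      destruct (Hd1 _ Hi) as (x' & i' & _ & HI & Heq); pair_inj.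
      apply (proj1 (proj2 HS)) in HI as (z & s & ->).
      (* The centre [z] belongs to its own neighbourhood, which is the singleton of the given
         point. *)
      assert (Hz : z = x').
      { apply (Hd x' _ HX Hi), (presents_section _ _ _ HS); left; reflexivity. }
      subst z; exists s; split; [exact Hi|].
      intros Hs; apply Hx, reached_exists; eauto.
Qed.

(** ** Hausdorff spaces *)

(* Each [n] is represented by the two points <<n, 0>> and <<n, 1>>: of two
   disjoint neighbourhoods at most one is cofinite, so one of them decides
   whether [R] has a witness for [n]. *)
Lemma effective_separation_projection :
  hausdorff_effcompact_effectively_hausdorff M -> projection_comprehension M.
Proof.
  intros H R; apply NNPP; intros HR.
  (* In [R2] both copies of [n] have exactly the witnesses that [n] has in [R]. *)
  destruct (@definable_comprehension M HM (fun p => exists n, n < p + 1 /\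
    exists e, e < p + 1 /\ exists w, w < p + 1 /\
    (p = <<<<n, e>>, w>> /\ <<n, w>> \in R))) as [R2 HR2]; [definable|].
  assert (HR2' : forall n e w, <<<<n, e>>, w>> \in R2 <-> <<n, w>> \in R).
  { intros n e w; rewrite HR2; split.
    - intros (n' & _ & e' & _ & w' & _ & Heq & Hw); pair_inj; exact Hw.
    - intros Hw; exists n; split; [le_pair|]; exists e; split; [le_pair|].
      exists w; split; [le_pair|auto]. }
  destruct (late_tail_space R2) as [S HS].
  destruct (H S (discrete_hausdorff (late_tail_discrete HS)))
    as (h0 & h1 & [Hf0 Ht0] & [Hf1 Ht1] & Hh).
  { split; [|exact (late_tail_finite_cover_relation HS)].
    apply (late_tail_compact HS); intros [X HX]; apply HR.
    destruct (@definable_comprehension M HM (fun n => <<n, 0>> \in X))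
      as [Y HY]; [definable|].
    exists Y; intros n; rewrite HY, HX; setoid_rewrite HR2'; reflexivity. }
  (* If [x] has a witness, a neighbourhood of [x] is cofinite unless it is centred at [x] with a
     stage that has reached the witness. *)
  assert (Hcof : forall x z s, late_tail R2 z s x ->
    (exists m, <<x, m>> \in R2) -> (z = x -> ~ reached R2 x s) ->
    exists b, forall y, b < y + 1 -> late_tail R2 z s y).
  { intros x z s Hzx Hx Hs.
    assert (Hz : (exists m, <<z, m>> \in R2) /\ ~ reached R2 z s).
    { destruct Hzx as [->|(_ & Hz & Hn)]; [auto|].
      split; [apply reached_exists; eauto|exact Hn]. }
    destruct (late_tail_cofinite (proj1 Hz) (proj2 Hz)) as [b Hb].
    exists b; intros y Hy; apply (Hb y Hy). }
  apply HR, (delta1_comprehension HM).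
  - apply sigma1_ex_definable; definable.
  (* Absence of a witness is recognised when neither chosen neighbourhood is centred at its own
     point with a reached stage; if there were a witness, both would be cofinite. *)
  - apply sigma1_ext with (fun e => exists t, exists z', exists s, exists z,
      <<<<<<e O, 0>>, <<e O, 1>>>>, <<z, s>>>> \in h0 /\
      <<<<<<e O, 0>>, <<e O, 1>>>>, <<z', t>>>> \in h1 /\
      (z = <<e O, 0>> -> ~ reached R2 <<e O, 0>> s) /\
      (z' = <<e O, 1>> -> ~ reached R2 <<e O, 1>> t)).
    2: { do 3 apply (sigma1_ex HM); apply sigma1_ex_definable.
         unfold reached; definable. }
    intros e; generalize (e O); clear e; intros n.
    assert (H0 : <<n, 0>> \in points S) by apply HS.
    assert (H1 : <<n, 1>> \in points S) by apply HS.
    split.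
    + intros (t & z' & s & z & Hz & Hz' & Hs & Ht) [m Hm].
      assert (Hne : <<n, 0>> <> <<n, 1>>).
      { intros Heq; apply (code_pair_inj HM) in Heq as [_ Heq].
        apply (succ_neq0 (RCA0_basic HM) (n := 0)).
        rewrite (num_add_0_l HM); symmetry; exact Heq. }
      destruct (Hh _ _ _ _ H0 H1 Hne Hz Hz') as (HU0 & HU1 & Hdisj).
      apply (presents_section _ _ _ HS) in HU0, HU1.
      destruct (Hcof _ _ _ HU0) as [b Hb]; [exists m; apply HR2', Hm|exact Hs|].
      destruct (Hcof _ _ _ HU1) as [b' Hb']; [exists m; apply HR2', Hm|exact Ht|].
      (* The sum lies in both final segments. *)
      apply (Hdisj (b + b')); split; apply (presents_section _ _ _ HS).
      * apply Hb; lt_by b'.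
      * apply Hb'; lt_by b.
    + intros Hn.
      assert (Hnot : forall e s, ~ reached R2 <<n, e>> s).
      { intros e s (w & _ & Hw); apply HR2' in Hw; eauto. }
      destruct (Ht0 <<<<n, 0>>, <<n, 1>>>>) as (i & Hi & _);
        [exists <<n, 0>>, <<n, 1>>; auto|].
      destruct (Ht1 <<<<n, 0>>, <<n, 1>>>>) as (j & Hj & _);
        [exists <<n, 0>>, <<n, 1>>; auto|].
      destruct (Hf0 _ Hi) as (p & i' & _ & HI & Heq); pair_inj.
      destruct (Hf1 _ Hj) as (p' & j' & _ & HJ & Heq); pair_inj.
      apply (proj1 (proj2 HS)) in HI as (z & s & ->), HJ as (z' & t & ->).
      exists t, z', s, z; auto.
Qed.

End Spaces.

(** * The five equivalences over [RCA0] *)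

Theorem mainTheorem2 :
  equivalent_over RCA0 compact_effectively_compact ACA0 /\
  equivalent_over RCA0 discrete_effectively_discrete ACA0 /\
  equivalent_over RCA0 discrete_effcompact_effectively_discrete ACA0 /\
  equivalent_over RCA0 hausdorff_effectively_hausdorff ACA0 /\
  equivalent_over RCA0 hausdorff_effcompact_effectively_hausdorff ACA0.
Proof.
  split; [|split; [|split; [|split]]]; intros M HM; split; intros H;
    try apply (projection_comprehension_ACA0 HM).
  - exact (effective_compactness_projection HM H).
  - exact (ACA0_compact_effectively_compact HM H).
  (* The reversal already follows from the restriction to effectively compact spaces. *)
  - apply (effective_discreteness_projection HM).
    intros S HS _; exact (H S HS).
  - exact (ACA0_discrete_effectively_discrete HM H).
  - exact (effective_discreteness_projection HM H).
  - intros S HS _; exact (ACA0_discrete_effectively_discrete HM H HS).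
  - apply (effective_separation_projection HM).
    intros S HS _; exact (H S HS).
  - exact (ACA0_hausdorff_effectively_hausdorff HM H).
  - exact (effective_separation_projection HM H).
  - intros S HS _; exact (ACA0_hausdorff_effectively_hausdorff HM H HS).
Qed.
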